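(* $(\mathcal S,\langle\cdot,\cdot\rangle_K)$ is a vector-valued reproducing kernel Hilbert space of $\mathbb R^N$-valued functions on $[0,T]$.
   Context: Setting. $T>0$ is finite, $N,M\ge1$ are integers. For $t\in[0,T]$: $\mathbf A(t)\in\mathbb R^{N,N}$, $\mathbf B(t)\in\mathbb R^{N,M}$, and $\mathbf Q(t)\in\mathbb R^{N,N}$, $\mathbf R(t)\in\mathbb R^{M,M}$ are (symmetric) positive semidefinite. Standing assumptions: $\mathbf A(\cdot)\in L^1(0,T)$, $\mathbf B(\cdot)\in L^2(0,T)$, $\mathbf Q(\cdot)\in L^1(0,T)$, $\mathbf R(\cdot)\in L^2(0,T)$, and there is $r>0$ with $\mathbf R(t)\succcurlyeq r\,\mathrm{Id}_M$ for all $t\in[0,T]$. Space of trajectories. $\mathcal S$ is the set of absolutely continuous $\mathbf x:[0,T]\to\mathbb R^N$ for which there is a measurable $\mathbf u:[0,T]\to\mathbb R^M$ with $\mathbf x'(t)=\mathbf A(t)\mathbf x(t)+\mathbf B(t)\mathbf u(t)$ a.e. and $\int_0^T\mathbf u(t)^\top\mathbf R(t)\mathbf u(t)\,dt<\infty$. To each $\mathbf x(\cdot)\in\mathcal S$ one associates the control $\mathbf u(t)=\mathbf B(t)^{\ominus}[\mathbf x'(t)-\mathbf A(t)\mathbf x(t)]$ a.e. in $[0,T]$, where $\mathbf B(t)^\ominus$ is the pseudoinverse of $\mathbf B(t)$ for the norm $\|\mathbf R(t)^{1/2}\cdot\|$ on $\mathbb R^M$ (i.e. $\mathbf u(t)$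 is the solution of $\mathbf B(t)\mathbf u=\mathbf x'(t)-\mathbf A(t)\mathbf x(t)$ of minimal $\|\mathbf R(t)^{1/2}\cdot\|$-norm). With $\mathbf u_1,\mathbf u_2$ the controls associated in this way to $\mathbf x_1,\mathbf x_2\in\mathcal S$, $$\langle\mathbf x_1,\mathbf x_2\rangle_K:=\mathbf x_1(0)^\top\mathbf x_2(0)+\int_0^T[\mathbf x_1(t)^\top\mathbf Q(t)\mathbf x_2(t)+\mathbf u_1(t)^\top\mathbf R(t)\mathbf u_2(t)]\,dt.$$ A Hilbert space $(\mathcal H_K,\langle\cdot,\cdot\rangle_K)$ of $\mathbb R^N$-valued functions on a non-empty set $\mathscr T$ is a vector-valued reproducing kernel Hilbert space (vRKHS) if there is $K:\mathscr T\times\mathscr T\to\mathbb R^{N,N}$ such that for all $t\in\mathscr T$, $\mathbf p\in\mathbb R^N$: $K(\cdot,t)\mathbf p\in\mathcal H_K$, and $\mathbf p^\top\mathbf f(t)=\langle\mathbf f,K(\cdot,t)\mathbf p\rangle_K$ for all $\mathbf f\in\mathcal H_K$. Equivalently, for every $t$ and $\mathbf p$ the functional $\mathbf f\mapsto\mathbf p^\top\mathbf f(t)$ is continuous on $\mathcal H_K$. *)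

(* Defs.v *)
From HB Require Import structures.
From mathcomp Require Export all_boot all_order all_algebra.
From mathcomp Require Export all_classical all_reals all_analysis.
Export Order.TTheory GRing.Theory Num.Theory.
Export numFieldNormedType.Exports.

Set Implicit Arguments.
Unset Strict Implicit.
Unset Printing Implicit Defensive.

Local Open Scope classical_set_scope.
Local Open Scope ring_scope.

Definition quad (R : realType) (n : nat) (P : 'M[R]_n) (u v : 'cV[R]_n) : R :=
  (u^T *m P *m v) 0 0.

Definition psd (R : realType) (n : nat) (P : 'M[R]_n) : Prop :=
  P^T = P /\ forall v : 'cV[R]_n, 0 <= quad P v v.

Definition Lp_mx (R : realType) (T p : R) (m n : nat) (F : R -> 'M[R]_(m, n)) :
    Prop :=
  forall i j,
    ((fun t : R => F t i j) \_ `[0, T]) \in Lfun (@lebesgue_measure R) p%:E.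

(** * Hilbert spaces and vector-valued RKHSs *)

Record is_hilbert (R : realType) (V : lmodType R) (H : set V)
    (ip : V -> V -> R) : Prop := IsHilbert {
  hilbert0 : H 0;
  hilbertP : forall (a : R) (f g : V), H f -> H g -> H (a *: f + g);
  hilbert_sym : forall f g : V, H f -> H g -> ip f g = ip g f;
  hilbert_lin : forall (a : R) (f g h : V), H f -> H g -> H h ->
    ip (a *: f + g) h = a * ip f h + ip g h;
  hilbert_ge0 : forall f : V, H f -> 0 <= ip f f;
  hilbert_def : forall f : V, H f -> ip f f = 0 -> f = 0;
  hilbert_complete : forall f_ : nat -> V, (forall n, H (f_ n)) ->
    (forall e : R, 0 < e -> exists n0, forall m n, (n0 <= m)%N -> (n0 <= n)%N ->
       Num.sqrt (ip (f_ m - f_ n) (f_ m - f_ n)) < e) ->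
    exists2 f : V, H f &
      (fun n => Num.sqrt (ip (f_ n - f) (f_ n - f))) @ \oo --> (0 : R) }.

Definition is_vRKHS (R : realType) (N : nat) (X : Type)
    (H : set (X -> 'cV[R]_N))
    (ip : (X -> 'cV[R]_N) -> (X -> 'cV[R]_N) -> R) : Prop :=
  [/\ [set: X] !=set0, is_hilbert H ip &
    exists K : X -> X -> 'M[R]_N, forall (t : X) (p : 'cV[R]_N),
      H (fun s => K s t *m p) /\
      forall f, H f -> (p^T *m f t) 0 0 = ip f (fun s => K s t *m p)].

(** * Trajectories on [[0, T]] *)

Definition seg (R : realType) (T : R) : Type := {t : R | 0 <= t <= T}.

(* Extension by 0 outside [0, T]; it is only used for evaluating at a real
   number and for differentiating at points of ]0, T[. *)
Definition ext (R : realType) (T : R) (N : nat) (x : seg T -> 'cV[R]_N) :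
    R -> 'cV[R]_N :=
  fun t => oapp x 0 (insub t).

Definition abs_continuous (R : realType) (T : R) (N : nat)
    (x : seg T -> 'cV[R]_N) : Prop :=
  forall e : R, 0 < e -> exists2 d : R, 0 < d &
    forall (n : nat) (a b : 'I_n -> seg T),
      (forall i, val (a i) <= val (b i)) ->
      trivIset [set: 'I_n] (fun i => `]val (a i), val (b i)[%classic) ->
      \sum_(i < n) (val (b i) - val (a i)) < d ->
      \sum_(i < n) `|x (b i) - x (a i)| < e.

(* The space of trajectories S; Rw is the control weight R(.). *)
Definition trajectories (R : realType) (T : R) (N M : nat)
    (A : R -> 'M[R]_N) (B : R -> 'M[R]_(N, M)) (Rw : R -> 'M[R]_M) :
    set (seg T -> 'cV[R]_N) :=
  [set x | abs_continuous x /\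
    exists u : R -> 'cV[R]_M,
      [/\ forall i, measurable_fun `[0, T] (fun t => u t i 0),
          {ae (@lebesgue_measure R), forall t : R, 0 <= t <= T ->
             is_derive t 1 (ext x) (A t *m ext x t + B t *m u t)} &
          (\int[@lebesgue_measure R]_(t in `[0%R, T])
             (quad (Rw t) (u t) (u t))%:E < +oo)%E]].

(* ‖P^{1/2} u‖ for P positive semidefinite. *)
Definition wnorm (R : realType) (M : nat) (P : 'M[R]_M) (u : 'cV[R]_M) : R :=
  Num.sqrt (quad P u u).

(* [pinv B P v] is the solution u of B u = v of minimal ‖P^{1/2} u‖, which is
   unique when P is positive definite.  It is 0 by convention when v is not in
   the range of B; along a trajectory this happens only on a null set. *)
Definition pinv (R : realType) (N M : nat) (B : 'M[R]_(N, M)) (P : 'M[R]_M)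
    (v : 'cV[R]_N) : 'cV[R]_M :=
  xget 0 [set u | B *m u = v /\
                  forall w, B *m w = v -> wnorm P u <= wnorm P w].

Definition control (R : realType) (T : R) (N M : nat)
    (A : R -> 'M[R]_N) (B : R -> 'M[R]_(N, M)) (Rw : R -> 'M[R]_M)
    (x : seg T -> 'cV[R]_N) : R -> 'cV[R]_M :=
  fun t => pinv (B t) (Rw t) ('D_1 (ext x) t - A t *m ext x t).

Definition ipK (R : realType) (T : R) (N M : nat)
    (A : R -> 'M[R]_N) (B : R -> 'M[R]_(N, M))
    (Q : R -> 'M[R]_N) (Rw : R -> 'M[R]_M) (x1 x2 : seg T -> 'cV[R]_N) : R :=
  ((ext x1 0)^T *m ext x2 0) 0 0 +
  \int[@lebesgue_measure R]_(t in `[0%R, T])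
    (quad (Q t) (ext x1 t) (ext x2 t) +
     quad (Rw t) (control A B Rw x1 t) (control A B Rw x2 t)).

(* Main.v *)
Require Import Defs.
From mathcomp Require Import simple_functions lebesgue_integral_definition measurable_realfun ring lra.

(** A space of paths is a reproducing kernel Hilbert space as soon as it is
    complete and evaluation at each time is bounded: the columns of the kernel
    are then the Riesz representatives ([riesz]) of the coordinates of
    evaluation.  Both facts are read off the state equation x' = A x + B u.

    The control attached to a path is defined by a pointwise minimization, and
    has to be put in a form suited to linear algebra and integration.  For a
    positive definite weight P, the solution of B u = v of minimal norm is the
    only one for which P u lies in the range of B^T ([pinv_minsol]).  This
    condition is linear, so that controls of minimal norm add up and the form
    is bilinear in the pairs (x, u) ([ipE]); by Pythagoras, a control can be
    exchanged for the minimal one without increasing its energy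
    ([sol_minimize]).  The minimal control is a limit of solutions of penalized
    problems, which are given by inverse matrices: this makes it measurable
    ([penalized_cvg], [measurable_pinv]).  The control of a path is specified
    only where the path is differentiable, hence almost everywhere, and
    [eq_ae_integral] makes the values on the remaining null set irrelevant.

    Evaluation is bounded because an absolutely continuous path is the integral
    of its derivative ([abs_cont_primitive]).  On an interval where the integral
    of |A| is below 1/2, the supremum of |x| is at most twice the sum of its
    value at the left end and of the integral of |B u|, which the energy of u
    controls.  Subdividing [0, T] into such intervals bounds x on the unit ball
    ([gronwall_subdivision], [sol_bounded], [eval_bounded]).

    For completeness, let x_n be a Cauchy sequence with minimal controls u_n.
    Bounded evaluation makes x_n converge uniformly to some f, and u_n converges
    in energy to some V ([energy_complete]).  The integrated state equation
    passes to the limit, so that f is a trajectory with control V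
    ([sol_limit]).  If w is the minimal control of f, then u_n - w is the
    minimal control of x_n - f and costs no more than u_n - V; hence x_n
    converges to f in norm ([ip_complete]). *)

Set Implicit Arguments.
Unset Strict Implicit.
Unset Printing Implicit Defensive.
Local Open Scope classical_set_scope.
Local Open Scope ring_scope.

(** * Quadratic forms *)

Section quad_theory.
Variables (R : realType) (n : nat).
Implicit Types (P : 'M[R]_n) (u v w : 'cV[R]_n) (a : R).

Lemma quadE P u v : quad P u v = \sum_i \sum_j u i 0 * P i j * v j 0.
Proof.
rewrite /quad mxE exchange_big/=; apply: eq_bigr => j _.
by rewrite mxE mulr_suml; apply: eq_bigr => i _; rewrite mxE.
Qed.

Lemma quadDl P u v w : quad P (u + v) w = quad P u w + quad P v w.
Proof. by rewrite /quad linearD/= !mulmxDl mxE. Qed.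

Lemma quadZl P a u w : quad P (a *: u) w = a * quad P u w.
Proof. by rewrite /quad linearZ/= -!scalemxAl mxE. Qed.

Lemma quadDr P u v w : quad P w (u + v) = quad P w u + quad P w v.
Proof. by rewrite /quad mulmxDr mxE. Qed.

Lemma quadZr P a u w : quad P w (a *: u) = a * quad P w u.
Proof. by rewrite /quad -scalemxAr mxE. Qed.

Lemma quadNl P u w : quad P (- u) w = - quad P u w.
Proof. by rewrite -scaleN1r quadZl mulN1r. Qed.

Lemma quadNr P u w : quad P w (- u) = - quad P w u.
Proof. by rewrite -scaleN1r quadZr mulN1r. Qed.

Lemma quadDp P P' u v : quad (P + P') u v = quad P u v + quad P' u v.
Proof. by rewrite /quad mulmxDr mulmxDl mxE. Qed.

Lemma quad_tr P u v : quad P^T u v = quad P v u.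
Proof.
have E : v^T *m P *m u = (u^T *m P^T *m v)^T by rewrite !trmx_mul !trmxK mulmxA.
by rewrite /quad E [RHS]mxE.
Qed.

Lemma quadC P u v : P^T = P -> quad P u v = quad P v u.
Proof. by move=> PT; rewrite -quad_tr PT. Qed.

Lemma quad_scalar a u : quad a%:M u u = a * \sum_i u i 0 ^+ 2.
Proof.
rewrite /quad mul_mx_scalar -scalemxAl mxE; congr (_ * _).
by rewrite mxE; apply: eq_bigr => i _; rewrite mxE.
Qed.

(** Coercivity enters the proof through this bound only. *)
Lemma psd_lb P a u : psd (P - a%:M) -> a * \sum_i u i 0 ^+ 2 <= quad P u u.
Proof.
move=> [_ /(_ u)]; rewrite quadDp -scaleN1r.
by rewrite scale_scalar_mx quad_scalar; lra.
Qed.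

(** From the positivity of the form at u + v and u - v.  This weak form of the
    Cauchy-Schwarz inequality gives integrability of mixed terms. *)
Lemma quad_le P u v : psd P -> `|quad P u v| <= quad P u u + quad P v v.
Proof.
move=> [PT P0].
have := P0 (u + v); have := P0 (u - v); have := P0 u; have := P0 v.
rewrite !(quadDl, quadDr, quadNl, quadNr) (quadC v u PT) => *.
by rewrite ler_norml; apply/andP; split; lra.
Qed.

Lemma quadD_le P u v : psd P ->
  quad P (u + v) (u + v) <= 2 * (quad P u u + quad P v v).
Proof.
move=> [PT P0]; have := P0 (u - v).
by rewrite !(quadDl, quadDr, quadNl, quadNr) (quadC v u PT) => *; lra.
Qed.

Lemma posdef_unitmx P : (forall u, quad P u u = 0 -> u = 0) -> P \in unitmx.
Proof.
move=> P0; rewrite -row_free_unit -kermx_eq0; apply/rowV0P => v /sub_kermxP vP.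
apply: trmx_inj; rewrite trmx0; apply: P0.
by rewrite /quad trmxK vP mul0mx mxE.
Qed.

End quad_theory.

Lemma sum_sqr_eq0 (R : realType) n (u : 'cV[R]_n) :
  \sum_i u i 0 ^+ 2 <= 0 -> u = 0.
Proof.
move=> u0; apply/colP => i; rewrite mxE; apply/eqP; rewrite -sqrf_eq0.
have /eqP : \sum_i u i 0 ^+ 2 == 0.
  by rewrite eq_le u0 sumr_ge0// => ? _; rewrite sqr_ge0.
move=> /psumr_eq0P => -> // j _; exact: sqr_ge0.
Qed.

(** * Solutions of minimal norm *)

Section minsol.
Variables (R : realType) (N M : nat) (B : 'M[R]_(N, M)) (P : 'M[R]_M).
Variable r : R.
Hypotheses (r_gt0 : 0 < r) (Pr : psd (P - r%:M)) (P_psd : psd P).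

(** The Lagrange condition for the minimization of the norm over the solutions
    of B u = v, with multiplier l.  Unlike minimality, it is visibly linear. *)
Definition minsol (u : 'cV[R]_M) := exists l : 'cV[R]_N, P *m u = B^T *m l.

Lemma quad_posdef (u : 'cV[R]_M) : quad P u u = 0 -> u = 0.
Proof.
move=> u0; apply: sum_sqr_eq0.
by have := psd_lb u Pr; rewrite u0 pmulr_rle0.
Qed.

Lemma weight_unitmx : P \in unitmx. Proof. exact/posdef_unitmx/quad_posdef. Qed.

Lemma minsolD a u v : minsol u -> minsol v -> minsol (a *: u + v).
Proof.
move=> [l Hl] [k Hk]; exists (a *: l + k).
by rewrite !mulmxDr -!scalemxAr Hl Hk.
Qed.

Lemma minsol_orth u w : minsol u -> B *m w = 0 -> quad P w u = 0.
Proof.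
move=> [l Hl] Bw; rewrite /quad -mulmxA Hl mulmxA -trmx_mul Bw trmx0 mul0mx.
by rewrite mxE.
Qed.

(** P u is in the range of B^T, hence u is orthogonal to the kernel of B. *)
Lemma minsol_pythagoras u w : minsol u -> B *m w = B *m u ->
  quad P w w = quad P u u + quad P (w - u) (w - u).
Proof.
move=> Hu Bwu; have Pwu : quad P (w - u) u = 0.
  by apply: minsol_orth => //; rewrite mulmxBr Bwu subrr.
have -> : quad P w w = quad P (w - u + u) (w - u + u) by rewrite subrK.
move: (w - u) Pwu => d Pdu.
by rewrite !(quadDl, quadDr) (quadC u d P_psd.1) Pdu addr0 add0r addrC.
Qed.

Lemma minsol_le u w : minsol u -> B *m w = B *m u -> quad P u u <= quad P w w.
Proof.
by move=> Hu /(minsol_pythagoras Hu) ->; rewrite lerDl; apply: P_psd.2.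
Qed.

(** The multiplier solves (B P^-1 B^T) l = B w.  This is solvable because
    B P^-1 B^T and B have the same left kernel, by definiteness of P, hence the
    same rank. *)
Lemma minsol_exists w : exists2 u, minsol u & B *m u = B *m w.
Proof.
pose C := B *m invmx P *m B^T.
have iPT : (invmx P)^T = invmx P by rewrite trmx_inv P_psd.1.
have CT : C^T = C by rewrite /C !trmx_mul trmxK iPT mulmxA.
have kCB : (kermx C <= kermx B)%MS.
  apply/rV_subP => v /sub_kermxP vC; apply/sub_kermxP.
  pose u := invmx P *m (v *m B)^T.
  have u0 : u = 0.
    apply: quad_posdef; rewrite /quad /u -mulmxA mulKVmx ?weight_unitmx//.
    have -> : (invmx P *m (v *m B)^T)^T *m (v *m B)^T = v *m C *m v^T.
      by rewrite !trmx_mul !trmxK iPT /C !mulmxA.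
    by rewrite vC mul0mx mxE.
  apply: trmx_inj; rewrite trmx0.
  by rewrite -[LHS](mulKVmx weight_unitmx) -/u u0 mulmx0.
have rBC : (\rank B <= \rank C)%N.
  have := mxrankS kCB; rewrite !mxrank_ker leq_sub2lE ?rank_leq_row//.
have CB : (C <= B^T)%MS by rewrite submxMl.
have BC : (B^T <= C)%MS.
  by rewrite -(geq_leqif (mxrank_leqif_sup CB)) mxrank_tr.
have : ((B *m w)^T <= C)%MS.
  by apply: submx_trans BC; rewrite trmx_mul submxMl.
case/submxP => l El.
have {El} : B *m w = C *m l^T by rewrite -[LHS]trmxK El trmx_mul CT.
move=> E; exists (invmx P *m (B^T *m l^T)).
  by exists l^T; rewrite mulKVmx ?weight_unitmx.
by rewrite E /C !mulmxA.
Qed.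

(** Uniqueness is the equality case of Pythagoras. *)
Lemma pinv_minsol u : minsol u -> pinv B P (B *m u) = u.
Proof.
move=> Hu; apply: xget_unique => /=.
  split=> // w Bwu; rewrite /wnorm ler_sqrt ?P_psd.2//.
  exact: minsol_le.
move=> w [Bwu] /(_ _ erefl); rewrite /wnorm ler_sqrt ?P_psd.2// => le_wu.
have := minsol_pythagoras Hu Bwu => E.
have /quad_posdef/eqP : quad P (w - u) (w - u) = 0.
  by apply/eqP; rewrite eq_le P_psd.2 andbT; lra.
by rewrite subr_eq0 => /eqP.
Qed.

Lemma pinv_sol w : B *m pinv B P (B *m w) = B *m w.
Proof. by have [u Hu <-] := minsol_exists w; rewrite pinv_minsol. Qed.

Lemma minsol_pinv w : minsol (pinv B P (B *m w)).
Proof. by have [u Hu <-] := minsol_exists w; rewrite pinv_minsol. Qed.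

(** Penalization: the minimizer of the quadratic functional
    P[z] + k |B z - B w|^2 tends to the solution of minimal norm as k grows.  It
    is given by an inverse matrix, hence depends measurably on the data. *)
Definition penalized (k : R) (w : 'cV[R]_M) : 'cV[R]_M :=
  invmx (P + k *: (B^T *m B)) *m (k *: (B^T *m (B *m w))).

Lemma quad_penalized k u :
  quad (P + k *: (B^T *m B)) u u = quad P u u + k * \sum_i (B *m u) i 0 ^+ 2.
Proof.
rewrite quadDp; congr (_ + _); rewrite /quad -scalemxAr -scalemxAl mxE.
rewrite mulmxA -trmx_mul -mulmxA mxE; congr (_ * _).
by apply: eq_bigr => i _; rewrite mxE.
Qed.

Lemma penalized_unit k : 0 <= k -> P + k *: (B^T *m B) \in unitmx.
Proof.
move=> k0; apply: posdef_unitmx => u; rewrite quad_penalized => E.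
apply: quad_posdef; apply/eqP; rewrite eq_le P_psd.2 andbT.
suff : 0 <= k * \sum_i (B *m u) i 0 ^+ 2 by lra.
by rewrite mulr_ge0// sumr_ge0// => i _; exact: sqr_ge0.
Qed.

(** The difference d satisfies (P + k B^T B) d = - B^T l.  Pairing with d and
    absorbing the cross term in k |B d|^2 leaves a bound of order 1/k. *)
Lemma penalized_le u l k w : P *m u = B^T *m l -> B *m w = B *m u -> 0 < k ->
  let d := penalized k w - u in
  quad P d d <= k^-1 * \sum_i l i 0 ^+ 2.
Proof.
move=> Hl Bwu k0; set d := penalized k w - u; move=> /=.
pose A := P + k *: (B^T *m B).
have Ad : A *m d = - (B^T *m l).
  rewrite /d mulmxBr /penalized mulKVmx ?penalized_unit ?(ltW k0)//.
  by rewrite /A mulmxDl Hl Bwu -scalemxAl -mulmxA opprD addrCA subrr addr0.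
have : quad A d d = - \sum_i (B *m d) i 0 * l i 0.
  rewrite /quad -mulmxA Ad mulmxN mxE mulmxA -trmx_mul mxE.
  by congr (- _); apply: eq_bigr => i _; rewrite mxE.
rewrite quad_penalized => E.
have : 0 <= \sum_i (k * (B *m d) i 0 ^+ 2 + (B *m d) i 0 * l i 0 + k^-1 * l i 0 ^+ 2).
  apply: sumr_ge0 => i _; set b := (B *m d) i 0; set c := l i 0.
  have -> : k * b ^+ 2 + b * c + k^-1 * c ^+ 2 = k * (b + k^-1 * c / 2) ^+ 2
     + k^-1 * c ^+ 2 * (3 / 4) by field; rewrite gt_eqF.
  have k1 : 0 <= k^-1 by rewrite invr_ge0 ltW.
  by have := mulr_ge0 (ltW k0) (sqr_ge0 (b + k^-1 * c / 2));
     have := mulr_ge0 k1 (sqr_ge0 c); lra.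
by rewrite !big_split/= -!mulr_sumr; lra.
Qed.

Lemma penalized_cvg w i :
  (fun k : nat => penalized k.+1%:R w i 0) @ \oo --> pinv B P (B *m w) i 0.
Proof.
set u := pinv _ _ _; have [l Hl] := minsol_pinv w; rewrite -/u in Hl.
have Bwu : B *m w = B *m u by rewrite /u pinv_sol.
set S := \sum_i l i 0 ^+ 2.
have S0 : 0 <= S by apply: sumr_ge0 => j _; exact: sqr_ge0.
have K k : (penalized k.+1%:R w i 0 - u i 0) ^+ 2 <= (r^-1 * S) * k.+1%:R^-1.
  set d := penalized k.+1%:R w - u.
  have dE : d i 0 = penalized k.+1%:R w i 0 - u i 0 by rewrite !mxE.
  rewrite -dE -mulrA ler_pdivlMl//.
  rewrite (le_trans _ (le_trans (psd_lb d Pr) _))//.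
    rewrite ler_pM2l// (bigD1 i)//= lerDl sumr_ge0// => j _; exact: sqr_ge0.
  by rewrite mulrC; exact: penalized_le.
apply/cvgrPdist_lt => e e0.
have C : (fun k : nat => (r^-1 * S) * k.+1%:R^-1) @ \oo --> (r^-1 * S) * 0.
  by apply: cvgMr; exact: cvg_harmonic.
rewrite mulr0 in C.
move/cvgrPdist_lt : C => /(_ (e ^+ 2)); rewrite exprn_gt0// => /(_ isT).
apply: filterS => k; rewrite sub0r normrN => H.
rewrite -(@ltr_pXn2r _ 2)// ?nnegrE ?normr_ge0 ?(ltW e0)//.
rewrite real_normK ?num_real// -opprB sqrrN (le_lt_trans (K k))//.
by rewrite (le_lt_trans _ H)// ler_norm.
Qed.

End minsol.

(** * Measurability of matrix-valued functions *)

Section measurable_matrix.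
Context d (X : measurableType d) (R : realType) (D : set X).

Definition measurable_mx m n (F : X -> 'M[R]_(m, n)) :=
  forall i j, measurable_fun D (fun t => F t i j).

(** Writing 1/x as x |x|^(-2) reduces to the measurability of powers. *)
Lemma measurable_invr (f : X -> R) :
  measurable_fun D f -> measurable_fun D (fun t => (f t)^-1).
Proof.
move=> mf; apply: (@eq_measurable_fun _ _ _ _ D (fun t => f t * ((f t ^+ 2) `^ (-1)))).
  move=> t _; rewrite powR_inv1 ?sqr_ge0//.
  have [->|f0] := eqVneq (f t) 0; first by rewrite invr0 mul0r.
  by rewrite expr2 invfM mulVKf.
apply: measurable_funM => //.
by apply: (measurableT_comp (measurable_powR _)); exact: measurable_funX.
Qed.

Lemma measurable_mulmx m n p (F : X -> 'M[R]_(m, n)) (G : X -> 'M[R]_(n, p)) :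
  measurable_mx F -> measurable_mx G -> measurable_mx (fun t => F t *m G t).
Proof.
move=> mF mG i j.
apply: (@eq_measurable_fun _ _ _ _ D (fun t => \sum_k F t i k * G t k j)).
  by move=> t _; rewrite mxE.
by apply: measurable_sum => k; exact: measurable_funM.
Qed.

Lemma measurable_addmx m n (F G : X -> 'M[R]_(m, n)) :
  measurable_mx F -> measurable_mx G -> measurable_mx (fun t => F t + G t).
Proof.
move=> mF mG i j; apply: (@eq_measurable_fun _ _ _ _ D (fun t => F t i j + G t i j)).
  by move=> t _; rewrite mxE.
exact: measurable_funD.
Qed.

Lemma measurable_scalemx m n (f : X -> R) (G : X -> 'M[R]_(m, n)) :
  measurable_fun D f -> measurable_mx G -> measurable_mx (fun t => f t *: G t).
Proof.
move=> mF mG i j; apply: (@eq_measurable_fun _ _ _ _ D (fun t => f t * G t i j)).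
  by move=> t _; rewrite mxE.
exact: measurable_funM.
Qed.

Lemma measurable_trmx m n (F : X -> 'M[R]_(m, n)) :
  measurable_mx F -> measurable_mx (fun t => (F t)^T).
Proof.
move=> mF i j; apply: (@eq_measurable_fun _ _ _ _ D (fun t => F t j i)) => //.
by move=> t _; rewrite mxE.
Qed.

Lemma measurable_det n (F : X -> 'M[R]_n) :
  measurable_mx F -> measurable_fun D (fun t => \det (F t)).
Proof.
move=> mF; rewrite /determinant; apply: measurable_sum => s.
apply: measurable_funM => //; apply: measurable_prod => i _; exact: mF.
Qed.

Lemma measurable_invmx n (F : X -> 'M[R]_n) : (forall t, D t -> F t \in unitmx) ->
  measurable_mx F -> measurable_mx (fun t => invmx (F t)).
Proof.
move=> uF mF i j.
apply: (@eq_measurable_fun _ _ _ _ D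
  (fun t => (\det (F t))^-1 * ((-1) ^+ (j + i) * \det (row' j (col' i (F t)))))).
  by move=> t /set_mem Dt; rewrite /invmx uF// !mxE.
apply: measurable_funM; first exact/measurable_invr/measurable_det.
apply: measurable_funM => //; apply: measurable_det => k l.
apply: (@eq_measurable_fun _ _ _ _ D (fun t => F t (lift j k) (lift i l))) => //.
by move=> t _; rewrite !mxE.
Qed.

Lemma measurable_quad n (P : X -> 'M[R]_n) (u v : X -> 'cV[R]_n) :
  measurable_mx P -> measurable_mx u -> measurable_mx v ->
  measurable_fun D (fun t => quad (P t) (u t) (v t)).
Proof.
move=> mP mu mv; rewrite /quad.
apply: (measurable_mulmx _ mv); apply: measurable_mulmx => //; exact: measurable_trmx.
Qed.

(** The pseudoinverse is a pointwise limit of [penalized], a rational function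
    of the data; its own definition by choice says nothing of measurability. *)
Lemma measurable_pinv N M (B : X -> 'M[R]_(N, M)) (P : X -> 'M[R]_M) u r : 0 < r ->
  (forall t, D t -> psd (P t - r%:M)) -> (forall t, D t -> psd (P t)) ->
  measurable_mx B -> measurable_mx P -> measurable_mx u ->
  measurable_mx (fun t => pinv (B t) (P t) (B t *m u t)).
Proof.
move=> r0 Pr P0 mB mP mu i j; rewrite (ord1 j).
apply: (@measurable_fun_cvg _ _ _ _
    (fun (k : nat) t => penalized (B t) (P t) k.+1%:R (u t) i 0)); last first.
  by move=> t Dt; apply: (penalized_cvg r0); [exact: Pr | exact: P0].
move=> k.
have mk : measurable_mx (fun t => k.+1%:R *: ((B t)^T *m (B t))).
  apply: measurable_scalemx => //; apply: measurable_mulmx => //.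
  exact: measurable_trmx.
apply: measurable_mulmx.
  apply: measurable_invmx; last exact: measurable_addmx.
  move=> t Dt; apply: (penalized_unit _ r0); [exact: Pr | exact: P0 | by []].
apply: measurable_scalemx => //; apply: measurable_mulmx.
  exact: measurable_trmx.
exact: measurable_mulmx.
Qed.

End measurable_matrix.

(** * The Riesz representation theorem *)

Section riesz.
Variables (R : realType) (V : lmodType R) (H : set V) (ip : V -> V -> R).
Hypothesis hH : is_hilbert H ip.

Local Notation hnorm f := (Num.sqrt (ip f f)).

Lemma hilbertZ a f : H f -> H (a *: f).
Proof. by move=> Hf; rewrite -[_ *: _]addr0; apply: hilbertP hH _ _ _ Hf (hilbert0 hH). Qed.

Lemma hilbertD f g : H f -> H g -> H (f + g).
Proof. by move=> Hf Hg; rewrite -[f]scale1r; exact: hilbertP hH _ _ _ Hf Hg. Qed.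

Lemma hilbertB f g : H f -> H g -> H (f - g).
Proof. by move=> Hf Hg; rewrite -scaleN1r; apply: hilbertD => //; exact: hilbertZ. Qed.

Lemma ip0l g : H g -> ip 0 g = 0.
Proof.
move=> Hg; have H0 := hilbert0 hH.
have := hilbert_lin hH (-1) H0 H0 Hg.
by rewrite scaler0 addr0 mulN1r; lra.
Qed.

Lemma ipZl a f g : H f -> H g -> ip (a *: f) g = a * ip f g.
Proof.
move=> Hf Hg; have := hilbert_lin hH a Hf (hilbert0 hH) Hg.
by rewrite addr0 => ->; rewrite ip0l ?addr0.
Qed.

Lemma ipDl f g h : H f -> H g -> H h -> ip (f + g) h = ip f h + ip g h.
Proof.
move=> Hf Hg Hh; have := hilbert_lin hH 1 Hf Hg Hh.
by rewrite scale1r mul1r.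
Qed.

Lemma ipDr f g h : H f -> H g -> H h -> ip h (f + g) = ip h f + ip h g.
Proof.
move=> Hf Hg Hh; rewrite (hilbert_sym hH)//; last exact: hilbertD.
by rewrite ipDl// (hilbert_sym hH Hf)// (hilbert_sym hH Hg).
Qed.

Lemma ipZr a f g : H f -> H g -> ip g (a *: f) = a * ip g f.
Proof.
move=> Hf Hg; rewrite (hilbert_sym hH)//; last exact: hilbertZ.
by rewrite ipZl// (hilbert_sym hH Hf).
Qed.

Lemma ipDZ s f g : H f -> H g ->
  ip (f + s *: g) (f + s *: g) = ip f f + 2 * s * ip f g + s ^+ 2 * ip g g.
Proof.
move=> Hf Hg; have Hsg := hilbertZ s Hg; have Hfg := hilbertD Hf Hsg.
rewrite ipDl// !ipDr// !ipZl// !ipZr// (hilbert_sym hH Hg)//; ring.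
Qed.

(** Evaluate at the minimizer, with q + 1 in place of q to avoid a case split at
    q = 0. *)
Lemma quadratic_lb (p q e : R) : 0 <= e -> 0 <= q ->
  (forall s, - e <= 2 * s * p + s ^+ 2 * q) -> p ^+ 2 <= e * (q + 1).
Proof.
move=> e0 q0 /(_ (- p / (q + 1))).
have q1 : 0 < q + 1 by lra.
set s := - p / (q + 1).
have ps : p = - s * (q + 1) by rewrite /s; field; rewrite gt_eqF.
move=> Hs; rewrite ps.
suff : s ^+ 2 * (q + 1) <= e.
  by move=> He; rewrite exprMn sqrrN [X in _ * X]expr2 mulrA ler_wpM2r// ltW.
suff : s ^+ 2 * (q + 2) <= e by have := sqr_ge0 s; nra.
by have := Hs; rewrite ps; nra.
Qed.

Lemma ip_cauchy_schwarz f g : H f -> H g -> ip f g ^+ 2 <= ip f f * (ip g g + 1).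
Proof.
move=> Hf Hg; apply: quadratic_lb; [exact: hilbert_ge0 hH _ Hf|exact: hilbert_ge0 hH _ Hg|].
move=> s; have := hilbert_ge0 hH (hilbertD Hf (hilbertZ s Hg)).
by rewrite ipDZ//; lra.
Qed.

(** The representative minimizes [ip f f - 2 * L f].  A minimizing sequence is
    Cauchy by the parallelogram law, and the first-order condition at its limit
    is the representation. *)
Theorem riesz (L : V -> R) (C : R) : 0 <= C ->
  (forall a f g, H f -> H g -> L (a *: f + g) = a * L f + L g) ->
  (forall f, H f -> `|L f| <= C * hnorm f) ->
  exists2 g, H g & forall f, H f -> L f = ip f g.
Proof.
move=> C0 Llin LC.
have H0 := hilbert0 hH.
have L0 : L 0 = 0 by have := Llin (-1) _ _ H0 H0; rewrite scaler0 addr0; lra.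
have LZ a f : H f -> L (a *: f) = a * L f.
  by move=> Hf; have := Llin a _ _ Hf H0; rewrite addr0 => ->; rewrite L0 addr0.
have LD f g : H f -> H g -> L (f + g) = L f + L g.
  by move=> Hf Hg; have := Llin 1 _ _ Hf Hg; rewrite scale1r mul1r.
pose J f := ip f f - 2 * L f.
pose S := [set J f | f in H].
have Slb : has_lbound S.
  exists (- C ^+ 2) => _ [f Hf <-]; rewrite /J.
  have := LC f Hf; rewrite ler_norml => /andP[_].
  have := sqr_sqrtr (hilbert_ge0 hH Hf); set n := hnorm f => <- H1.
  by have := sqr_ge0 (n - C); nra.
have Sinf : has_inf S by split => //; exists (J 0), 0.
pose eps n : R := n.+1%:R^-1.
have eps0 n : 0 < eps n by rewrite invr_gt0 ltr0n.
have /choice[f_ f_P] : forall n, exists f, H f /\ J f <= inf S + eps n.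
  move=> n; have [_ [f Hf <-] Jf] := inf_adherent (eps0 n) Sinf.
  by exists f; split => //; exact: ltW.
have Hf_ n := (f_P n).1; have Jf_ n := (f_P n).2.
have infJ f : H f -> inf S <= J f by move=> Hf; apply: ge_inf => //; exists f.
have cauchy m n : ip (f_ m - f_ n) (f_ m - f_ n) <= 2 * (eps m + eps n).
  have Hmn := hilbertD (Hf_ m) (Hf_ n).
  have := infJ _ (hilbertZ 2^-1 Hmn).
  have := Jf_ m; have := Jf_ n; rewrite /J.
  rewrite ipZl ?ipZr ?LZ ?LD//; last exact: hilbertZ.
  rewrite -scaleN1r (ipDZ _ (Hf_ m) (Hf_ n)).
  have := ipDZ 1 (Hf_ m) (Hf_ n); rewrite scale1r => ->; lra.
have epsC : eps n @[n --> \oo] --> (0 : R) by exact: cvg_harmonic.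
have small e : 0 < e -> exists n0, forall n, (n0 <= n)%N -> eps n < e.
  move=> e0; move/cvgrPdist_lt : epsC => /(_ e e0) [n0 _ Hn].
  exists n0 => n /Hn /=; rewrite sub0r normrN; apply: le_lt_trans; exact: ler_norm.
have [||g Hg gC] := hilbert_complete hH (f_ := f_) => //.
  move=> e e0; have [n0 Hn0] := small (e ^+ 2 / 4) (divr_gt0 (exprn_gt0 _ e0) (ltr0Sn _ _)).
  exists n0 => m n /Hn0 em /Hn0 en.
  rewrite -(@ltr_pXn2r _ 2)// ?nnegrE ?sqrtr_ge0 ?(ltW e0)//.
  rewrite sqr_sqrtr; last by apply: (hilbert_ge0 hH); exact: hilbertB.
  by have := cauchy m n; lra.
exists g => // h Hh.
have q0 := hilbert_ge0 hH Hh.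
apply/eqP; rewrite -subr_eq0 -sqrf_eq0 eq_le sqr_ge0 andbT.
apply/ler_addgt0Pl => e e0; rewrite addr0.
(* both the defect of f_ n and its distance to the limit are made small *)
pose e' := e / (4 * (ip h h + 1)).
have e'0 : 0 < e' by rewrite divr_gt0// mulr_gt0//; lra.
have [n1 Hn1] := small e' e'0.
move/cvgrPdist_lt : gC => /(_ (Num.sqrt e')); rewrite sqrtr_gt0 => /(_ e'0) [n2 _ Hn2].
pose n := maxn n1 n2.
have En : eps n < e' by apply: Hn1; exact: leq_maxl.
have Gn : ip (f_ n - g) (f_ n - g) < e'.
  have /Hn2 /= : (n2 <= n)%N by exact: leq_maxr.
  by rewrite sub0r normrN ger0_norm ?sqrtr_ge0// ltr_sqrt.
have Hd := hilbertB (Hf_ n) Hg.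
have A := ip_cauchy_schwarz Hd Hh.
have B : (ip (f_ n) h - L h) ^+ 2 <= eps n * (ip h h + 1).
  apply: quadratic_lb => //; first exact: ltW.
  move=> s; have Hsh := hilbertZ s Hh.
  have := infJ _ (hilbertD (Hf_ n) Hsh); have := Jf_ n.
  by rewrite /J ipDZ// LD// LZ//; lra.
have E : ip (f_ n - g) h = ip (f_ n) h - ip h g.
  rewrite ipDl//; last by rewrite -scaleN1r; exact: hilbertZ.
  by rewrite -scaleN1r ipZl// mulN1r (hilbert_sym hH Hg).
rewrite E in A.
have Q1 : 0 < ip h h + 1 by lra.
have A' : (ip (f_ n) h - ip h g) ^+ 2 <= e' * (ip h h + 1).
  by apply: le_trans A _; rewrite ler_wpM2r ?ltW.
have B' : (ip (f_ n) h - L h) ^+ 2 <= e' * (ip h h + 1).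
  by apply: le_trans B _; rewrite ler_wpM2r ?ltW.
have e'E : e' * (ip h h + 1) = e / 4 by rewrite /e'; field; rewrite gt_eqF.
rewrite e'E in A' B'; move: A' B'.
set x := ip (f_ n) h; set y := L h; set z := ip h g.
by have := sqr_ge0 ((x - z) + (x - y)); nra.
Qed.

End riesz.

(** * Integrals of functions equal almost everywhere *)

Section ae_integral.
Context d (X : measurableType d) (R : realType) (mu : {measure set X -> \bar R}).
Import HBNNSimple.
Local Open Scope ereal_scope.

(** The common bound: a simple function below f, cut off where f and g differ,
    is below g. *)
Lemma ge0_ae_le_integral (f g : X -> \bar R) :
  (forall x, 0 <= f x) -> (forall x, 0 <= g x) -> {ae mu, forall x, f x = g x} ->
  \int[mu]_x f x <= \int[mu]_x g x.
Proof.
move=> f0 g0 [Z [mZ Z0 ZS]]; rewrite [leLHS]ge0_integralTE//.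
apply: ge_ereal_sup => _ [h /= hf <-].
rewrite -integralT_nnsfun.
pose h' := proj_nnsfun h (measurableC mZ).
have h'E x : h' x = (h \_ (~` Z)) x by rewrite (mrestrict h (measurableC mZ)).
have -> : \int[mu]_x (h x)%:E = \int[mu]_x (h' x)%:E.
  apply: ge0_ae_eq_integral => //.
  - by apply/measurable_EFinP; exact: measurable_funP.
  - by apply/measurable_EFinP; exact: measurable_funP.
  - by move=> x _; rewrite lee_fin.
  - by move=> x _; rewrite lee_fin.
  - exists Z; split => // x Hx; apply: contrapT => Zx; apply: Hx => _.
    by congr EFin; rewrite h'E patchE mem_set.
rewrite integralT_nnsfun ge0_integralTE//; apply: ereal_sup_ubound; exists h' => // x.
rewrite h'E patchE; case: ifPn => // /set_mem Zx.
have <- : f x = g x by apply: contrapT => /ZS.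
exact: hf.
Qed.

(** Valid for arbitrary functions: the integral of a nonnegative function is a
    supremum over the simple functions below it, and cutting these off on a null
    set does not change their integral.  It is meant for controls, whose values
    on the null set of bad times are unspecified. *)
Lemma eq_ae_integral (D : set X) (f g : X -> \bar R) :
  {ae mu, forall x, D x -> f x = g x} ->
  \int[mu]_(x in D) f x = \int[mu]_(x in D) g x.
Proof.
move=> fg.
have H (a b : X -> \bar R) : (forall x, 0 <= a x) -> (forall x, 0 <= b x) ->
    {ae mu, forall x, D x -> a x = b x} ->
    \int[mu]_(x in D) a x = \int[mu]_(x in D) b x.
  move=> a0 b0 ab; rewrite integral_mkcond [RHS]integral_mkcond.
  have r0 (c : X -> \bar R) x : (forall x, 0 <= c x) -> 0 <= (c \_ D) x.
    by move=> c0; rewrite patchE; case: ifPn.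
  apply/eqP; rewrite eq_le; apply/andP; split; apply: ge0_ae_le_integral;
    try (by move=> x; exact: r0); apply: filterS ab => x abx; rewrite !patchE;
    by case: ifPn => // /set_mem /abx.
rewrite integralE [RHS]integralE; congr (_ - _); apply: H => //;
  by apply: filterS fg => x /[apply] fgx; rewrite ?funeposE ?funenegE fgx.
Qed.

Lemma eq_ae_Rintegral (D : set X) (f g : X -> R) :
  {ae mu, forall x, D x -> f x = g x} ->
  (\int[mu]_(x in D) f x = \int[mu]_(x in D) g x)%R.
Proof.
move=> fg; rewrite /Rintegral; congr fine; apply: eq_ae_integral.
by apply: filterS fg => x /[apply] ->.
Qed.

End ae_integral.

(** * Absolutely continuous functions *)

Section abs_cont.
Variable R : realType.
Implicit Types (T t s e d : R) (f g : R -> R).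
Local Notation mu := (@lebesgue_measure R).

Definition abs_cont T f := forall e, 0 < e -> exists2 d, 0 < d &
  forall n (a b : 'I_n -> R),
    (forall i, [/\ 0 <= a i, a i <= b i & b i <= T]) ->
    trivIset [set: 'I_n] (fun i => `]a i, b i[%classic) ->
    \sum_(i < n) (b i - a i) < d ->
    \sum_(i < n) `|f (b i) - f (a i)| < e.

Lemma abs_contS T T' f : T' <= T -> abs_cont T f -> abs_cont T' f.
Proof.
move=> TT' fT e /fT[d d0 fd]; exists d => // n a b ab; apply: fd => i.
by have [? ? ?] := ab i; split => //; exact: le_trans TT'.
Qed.

Lemma abs_cont_lin T k f g : abs_cont T f -> abs_cont T g ->
  abs_cont T (fun t => k * f t + g t).
Proof.
move=> fT gT e e0.
have k1 : 0 < `|k| + 1 by rewrite ltr_wpDl.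
have e20 : 0 < e / 2 by rewrite divr_gt0.
have [d d0 fd] := fT _ (divr_gt0 e20 k1); have [d' d'0 gd] := gT _ e20.
exists (Num.min d d'); first by rewrite lt_min d0.
move=> n a b ab tab; rewrite lt_min => /andP[sd sd'].
have := fd n a b ab tab sd; rewrite ltr_pdivlMr// => fe.
rewrite (splitr e); apply: le_lt_trans (ltrD fe (gd n a b ab tab sd')).
rewrite mulr_suml -big_split/=; apply: ler_sum => i _.
have -> : k * f (b i) + g (b i) - (k * f (a i) + g (a i)) =
  k * (f (b i) - f (a i)) + (g (b i) - g (a i)) by ring.
apply: le_trans (ler_normD _ _) _; rewrite lerD2r normrM mulrC ler_wpM2l// lerDl//.
Qed.

Lemma abs_contB T f g : abs_cont T f -> abs_cont T g -> abs_cont T (f \- g).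
Proof.
move=> fT gT; have := abs_cont_lin (-1) gT fT.
by congr abs_cont; apply/funext => t; rewrite mulN1r addrC.
Qed.

Lemma lebesgue_itvoo (a b : R) : a <= b -> mu `]a, b[ = (b - a)%:E.
Proof.
move=> ab; rewrite lebesgue_measure_itv/= lte_fin.
case: ltP => [_|ba]; first by rewrite EFinD EFinN.
by have -> : b - a = 0 by lra.
Qed.

Lemma sum_length_le n (a b : 'I_n -> R) (U : set R) : measurable U ->
  (forall i, a i <= b i) -> (forall i, `]a i, b i[ `<=` U) ->
  trivIset [set: 'I_n] (fun i => `]a i, b i[%classic) ->
  ((\sum_(i < n) (b i - a i))%:E <= mu U)%E.
Proof.
move=> mU ab abU tab.
rewrite -sumEFin (eq_bigr (fun i => mu `]a i, b i[)); last first.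
  by move=> i _; rewrite lebesgue_itvoo.
rewrite -(measure_bigsetU_ord mu predT)//.
apply: le_measure; rewrite ?inE//; first exact: bigsetU_measurable.
by move=> x; rewrite -bigcup_seq => -[i _]; exact: abU.
Qed.

Section cousin.
Variables (f : R -> R) (e : R) (U : set R).
Hypothesis e_gt0 : 0 < e.

(** Records a partition of [0, s] fine for the gauge.  The list keeps only the
    intervals inside U, from right to left; the other ones, where the slope of f
    is at most e, contribute the term e * s. *)
Definition chain s (l : seq (R * R)) :=
  [/\ pairwise (fun p q => q.2 <= p.1) l,
      (forall p, p \in l -> [/\ 0 <= p.1, p.1 <= p.2, p.2 <= s & `]p.1, p.2[ `<=` U]) &
      `|f s - f 0| <= e * s + \sum_(p <- l) `|f p.2 - f p.1|].

Definition controlled t r :=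
  ball t r `<=` U \/ forall s, `|s - t| < r -> `|f s - f t| <= e * `|s - t|.

(** One more interval [s, s'], tagged by t: it joins the list if t is covered by
    U, and only extends the slope term otherwise. *)
Lemma chain_step t r s s' l : 0 <= s -> s <= t -> t <= s' -> t - s < r -> s' - t < r ->
  controlled t r -> chain s l -> exists l', chain s' l'.
Proof.
move=> s0 st ts' sr s'r ctr [pl lP fl]; have ss' : s <= s' := le_trans st ts'.
have tri : `|f s' - f 0| <= `|f s' - f s| + `|f s - f 0|.
  by rewrite -[in leLHS](subrKA (f s)); exact: ler_normD.
case: ctr => [trU|slope].
- exists ((s, s') :: l); split.
  + by rewrite /= pl andbT; apply/allP => p /lP[_ _].
  + move=> p; rewrite inE => /predU1P[->|/lP[? ? ps ?]]; last first.
      by split => //; exact: le_trans ss'.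
    split => //= x /=; rewrite in_itv/= => /andP[sx xs'].
    by apply: trU; rewrite /ball/= ltr_norml; apply/andP; split; lra.
  + have es : e * s <= e * s' by rewrite ler_pM2l.
    by rewrite big_cons/=; lra.
- exists l; split => //.
    by move=> p /lP[? ? ps ?]; split => //; exact: le_trans ss'.
  have := slope s'; rewrite ger0_norm ?subr_ge0// => /(_ s'r).
  have := slope s; rewrite distrC ger0_norm ?subr_ge0// => /(_ sr).
  have : `|f s' - f s| <= `|f s' - f t| + `|f s - f t|.
    by rewrite (distrC (f s)) -[in leLHS](subrKA (f t)); exact: ler_normD.
  by move: tri fl; rewrite (_ : e * s' = e * s + e * (s' - t) + e * (t - s)); [lra|ring].
Qed.

(** The intervals of a chain are disjoint and contained in U, so absolute
    continuity applies to them. *)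
Lemma sum_chain_lt T d s l : s <= T -> measurable U -> (mu U < d%:E)%E ->
  (forall n (a b : 'I_n -> R),
    (forall i, [/\ 0 <= a i, a i <= b i & b i <= T]) ->
    trivIset [set: 'I_n] (fun i => `]a i, b i[%classic) ->
    \sum_(i < n) (b i - a i) < d ->
    \sum_(i < n) `|f (b i) - f (a i)| < e) ->
  chain s l -> \sum_(p <- l) `|f p.2 - f p.1| < e.
Proof.
move=> sT mU Ud fd [pl lP _].
pose a (i : 'I_(size l)) := (nth (0, 0) l i).1.
pose b (i : 'I_(size l)) := (nth (0, 0) l i).2.
have lab i : [/\ 0 <= a i, a i <= b i, b i <= s & `]a i, b i[ `<=` U].
  by apply: lP; rewrite mem_nth.
have tab : trivIset [set: 'I_(size l)] (fun i => `]a i, b i[%classic).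
  apply/trivIsetP => i j _ _.
  wlog ij : i j / (i < j)%N.
    move=> H ij; have [lij|ji|E] := ltngtP i j; [exact: H| |].
      by rewrite setIC; apply: H => //; rewrite eq_sym.
    by move: ij; rewrite (val_inj E) eqxx.
  move=> _; have := pairwiseP (0, 0) pl i j; rewrite !inE => /(_ (ltn_ord i) (ltn_ord j) ij).
  rewrite -/(a i) -/(b j) => ba.
  apply/disj_set2P/disj_setPS => x [] /=; rewrite !in_itv/= => /andP[? _] /andP[_ ?].
  by move: ba; rewrite leNgt => /negP; apply; lra.
rewrite (big_nth (0, 0)) big_mkord; apply: fd => //.
  by move=> i; have [? ? ? _] := lab i; split => //; exact: le_trans sT.
rewrite -lte_fin; apply: le_lt_trans Ud; apply: sum_length_le => //.
  by move=> i; case: (lab i).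
by move=> i; case: (lab i).
Qed.

End cousin.

Lemma is_derive0_small f t e : 0 < e -> is_derive t 1 f 0 ->
  exists2 r, 0 < r & forall s, `|s - t| < r -> `|f s - f t| <= e * `|s - t|.
Proof.
move=> e0 ft.
have [dft ft0] := ft.
have : h^-1 *: (f (h *: 1 + t) - f t) @[h --> 0^'] --> 'D_1 f t by exact: dft.
rewrite ft0.
move/cvgrPdist_lt => /(_ e e0) [r /= r0 Hr]; exists r => // s st.
have [->|st0] := eqVneq s t; first by rewrite !subrr normr0 mulr0.
have h0 : s - t != 0 by rewrite subr_eq0.
have := Hr (s - t); rewrite /= sub0r normrN => /(_ st h0).
rewrite sub0r normrN normrZ normfV [_ *: 1]mulr1 subrK => H.
by rewrite mulrC -ler_pdivrMl ?normr_gt0// ltW.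
Qed.

(** Gauge argument: tag each point t of [0, T] with a radius below which either
    the slope of f at t is small, or the interval stays in an open set of small
    measure containing the exceptional set.  A partition of [0, T] fine for this
    gauge bounds the variation of f.  Such a partition exists (Cousin's lemma):
    the supremum of the s for which [0, s] has one cannot be less than T. *)
Lemma abs_cont_derive0 T f : 0 <= T -> abs_cont T f ->
  {ae mu, forall t, 0 <= t <= T -> is_derive t 1 f 0} -> f T = f 0.
Proof.
move=> T0 fT [Z [mZ Z0 ZS]].
suff H e : 0 < e -> `|f T - f 0| <= e * (T + 1).
  apply/eqP; rewrite -subr_eq0 -normr_le0; apply/ler_addgt0Pl => e e0; rewrite addr0.
  have T1 : 0 < T + 1 by lra.
  by have := H (e / (T + 1)) (divr_gt0 e0 T1); rewrite divfK// gt_eqF.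
move=> e0; have [d d0 fd] := fT e e0.
have [U [oU ZU Ud]] : exists U : set R, [/\ open U, Z `<=` U & (mu (U `\` Z) < d%:E)%E].
  by apply: lebesgue_regularity_outer => //; rewrite [X in (X < _)%E]Z0.
have mU : measurable U := open_measurable oU.
have {}Ud : (mu U < d%:E)%E.
  have UE : U = (U `\` Z) `|` Z by rewrite setUC setDUK.
  rewrite UE (le_lt_trans (measureU2 _ _ _))//; first exact: measurableD.
  by rewrite [X in (_ + X < _)%E]Z0 adde0.
have gauge t : 0 <= t <= T -> exists2 r, 0 < r & controlled f e U t r.
  move=> tT; have [Zt|Zt] := pselect (Z t).
    have /nbhs_ballP[r r0 rU] : nbhs t U by apply: open_nbhs_nbhs; split => //; exact: ZU.
    by exists r => //; left.
  have ft : is_derive t 1 f 0.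
    by apply: contrapT => nft; apply: Zt; apply: ZS => /= /(_ tT).
  by have [r r0 rP] := is_derive0_small e0 ft; exists r => //; right.
pose S := [set s | 0 <= s <= T /\ exists l, chain f e U s l].
have S0 : S 0.
  split; first by rewrite lexx.
  by exists [::]; split => //; rewrite big_nil subrr normr0 mulr0 addr0.
have Sub : has_ubound S by exists T => s [/andP[]].
have Ssup : has_sup S by split => //; exists 0.
have s0 : 0 <= sup S by exact: ub_le_sup.
have sT : sup S <= T by apply: ge_sup => //; [exists 0|move=> s [/andP[]]].
(* a partition that stops just before sup S extends past it in one step *)
have [r r0 ctr] := gauge (sup S) (introT andP (conj s0 sT)).
have [s Ss rs] := sup_adherent r0 Ssup.
have ss : s <= sup S by exact: ub_le_sup.
have [/andP[s_ge0 _] [l sl]] := Ss.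
pose s' := Num.min T (sup S + r / 2).
have [l' s'l'] : exists l', chain f e U s' l'.
  apply: (chain_step e0 _ ss _ _ _ ctr sl) => //.
  - by rewrite le_min sT lerDl divr_ge0// ltW.
  - by lra.
  - by rewrite /s' /Num.min; case: ifP => ?; lra.
have s's : s' <= sup S.
  apply: ub_le_sup => //; split; last by exists l'.
  by rewrite /s' ge_min lexx le_min T0/= andbT addr_ge0// divr_ge0// ltW.
have TE : s' = T.
  by move: s's; rewrite /s' /Num.min; case: ifP => //; lra.
move: s'l'; rewrite TE => chT.
have := sum_chain_lt (lexx T) mU Ud fd chT.
by case: chT => _ _; lra.
Qed.

End abs_cont.

#[global] Instance lebesgue_ae_filter (R : realType) :
  Filter (nbhs (almost_everywhere (@lebesgue_measure R))).
Proof. exact: (ae_filter_ringOfSetsType (@lebesgue_measure R)). Qed.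

Section primitive.
Variables (R : realType) (T : R) (g : R -> R).
Local Notation mu := (@lebesgue_measure R).
Hypothesis intg : mu.-integrable `[0, T] (EFin \o g).

Definition primitive t := \int[mu]_(s in `[0, t]) g s.

Lemma integrable_subitv (I : interval R) : [set` I] `<=` `[0, T] ->
  mu.-integrable [set` I] (EFin \o g).
Proof. by move=> IT; apply: integrableS intg. Qed.

Lemma primitive0 : primitive 0 = 0.
Proof. by rewrite /primitive set_itv1 Rintegral_set1. Qed.

Lemma primitiveB a b : 0 <= a -> a <= b -> b <= T ->
  primitive b - primitive a = \int[mu]_(s in `]a, b]) g s.
Proof.
move=> a0 ab bT; rewrite /primitive (@Rintegral_itvB _ g (BLeft 0) (BRight b)) ?bnd_simp//.
by apply: integrable_subitv; apply: subset_itvl; rewrite bnd_simp.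
Qed.

Lemma primitiveB_le a b : 0 <= a -> a <= b -> b <= T ->
  `|primitive b - primitive a| <= \int[mu]_(s in `]a, b]) `|g s|.
Proof.
move=> a0 ab bT; rewrite primitiveB//; apply: le_normr_Rintegral => //.
by apply: integrable_subitv; apply: subset_itv; rewrite bnd_simp.
Qed.

Let G := g \_ `[0, T].

Let intG : mu.-integrable setT (EFin \o G).
Proof. by rewrite /G -restrict_EFin -integrable_mkcond. Qed.

Lemma integral_small e : 0 < e -> exists2 d, 0 < d & forall A : set R, measurable A ->
  A `<=` `[0, T] -> (mu A < d%:E)%E -> \int[mu]_(x in A) `|g x| < e.
Proof.
move=> /(integral_normr_continuous intG)[d [d0 Hd]]; exists d => // A mA AT mud.
have := Hd A mA mud; congr (_ < _); apply: eq_Rintegral => x /set_mem /AT xT.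
by rewrite /G patchE mem_set.
Qed.

(** Absolute continuity of the integral with respect to the measure, applied to
    the union of the intervals. *)
Lemma primitive_abs_cont : abs_cont T primitive.
Proof.
move=> e /integral_small[d d0 Hd]; exists d => // n a b ab tab sd.
have ab' i : a i <= b i by case: (ab i).
have abT i : `]a i, b i[ `<=` `[0, T].
  by case: (ab i) => *; apply: subset_itv; rewrite bnd_simp.
pose A := \big[setU/set0]_(i < n) `]a i, b i[%classic.
have AT : A `<=` `[0, T] by move=> x; rewrite /A -bigcup_seq => -[i _]; exact: abT.
have mA : measurable A by exact: bigsetU_measurable.
have muA : mu A = (\sum_(i < n) (b i - a i))%:E.
  rewrite /A (measure_bigsetU_ord mu predT)// -sumEFin.
  by apply: eq_bigr => i _; exact: lebesgue_itvoo.
have intA : mu.-integrable A (EFin \o (fun x => `|g x|)).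
  by apply: integrable_norm; apply: integrableS intg.
have intAE : \int[mu]_(x in A) `|g x| = \sum_(i < n) \int[mu]_(x in `]a i, b i[) `|g x|.
  apply: EFin_inj; rewrite -sumEFin /Rintegral fineK; last exact: integrable_fin_num.
  rewrite (@ge0_integral_bigsetU _ _ _ mu)//=.
  - apply: eq_bigr => i _; rewrite fineK//; apply: integrable_fin_num => //.
    by apply: (@integrable_norm _ _ _ mu); exact: integrable_subitv.
  - exact: index_enum_uniq.
  - by apply: sub_trivIset tab => i.
  - by case/integrableP: intA.
have := Hd A mA AT; rewrite muA lte_fin => /(_ sd); rewrite intAE.
apply: le_lt_trans; apply: ler_sum => i _; case: (ab i) => ai abi bi.
apply: le_trans (primitiveB_le ai abi bi) _.
rewrite -(@Rintegral_itv_bndo_bndc _ (BRight (a i)))//.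
by apply: (@integrable_norm _ _ _ mu); exact: integrable_subitv.
Qed.

(** The Lebesgue differentiation theorem. *)
Lemma primitive_is_derive : {ae mu, forall t, 0 <= t <= T -> is_derive t 1 primitive (g t)}.
Proof.
pose F x := \int[mu]_(t in `[0, x]) G t.
have intGy y : mu.-integrable `[0, y] (EFin \o G) by apply: integrableS intG.
have locG : locally_integrable [set: R] G by exact: integrable_locally.
have := FTC1 intGy locG; rewrite -/F.
have neq_ae a : {ae mu, forall x : R, x != a}.
  exists [set a]; split; [exact: measurable_set1|exact: lebesgue_measure_set1|].
  by move=> x /= /negP; rewrite negbK => /eqP.
apply: filterS3 (neq_ae 0) (neq_ae T) => x xn0 xT dF /andP[x0 xleT].
have {xleT} xltT : x < T by rewrite lt_neqAle xT.
have [] := dF; first by rewrite /= lte_fin lt_neqAle eq_sym xn0.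
move=> dFx; rewrite derive1E => dFxE.
have near_eq : {near x, F =1 primitive}.
  near=> y; rewrite /F /primitive; apply: eq_Rintegral => z /set_mem.
  rewrite /= in_itv/= => /andP[z0 zy]; rewrite /G patchE mem_set//= in_itv/= z0/=.
  rewrite (le_trans zy)// ltW//; near: y; exact: lt_nbhsl.
apply: DeriveDef; first exact: near_eq_derivable dFx.
rewrite -(near_eq_derive _ near_eq)// dFxE /G patchE mem_set//=.
by rewrite in_itv/= x0 ltW.
Unshelve. all: by end_near. Qed.

(** The fundamental theorem of calculus for absolutely continuous functions: the
    difference with the primitive of the derivative has zero derivative. *)
Lemma abs_cont_primitive f : 0 <= T -> abs_cont T f ->
  {ae mu, forall t, 0 <= t <= T -> is_derive t 1 f (g t)} ->
  forall t, 0 <= t <= T -> f t = f 0 + primitive t.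
Proof.
move=> T0 fT fg t /andP[t0 tT].
suff : (f \- primitive) t = (f \- primitive) 0.
  by rewrite /= primitive0 subr0 => <-; rewrite subrK.
apply: abs_cont_derive0 => //.
  by apply: abs_contS tT _; apply: abs_contB => //; exact: primitive_abs_cont.
have := primitive_is_derive; apply: filterS2 fg => s fs gs /andP[s0 st].
have sT : 0 <= s <= T by rewrite s0 (le_trans st).
have := is_deriveB (fs sT) (gs sT); by rewrite subrr.
Qed.

End primitive.

(** * A Gronwall inequality by subdivision *)

(** The bound doubles, up to c, on each interval of length delta, since half of
    the supremum of y over the interval is absorbed in the left-hand side. *)
Lemma gronwall_subdivision (R : realType) (T delta : R) : 0 < delta ->
  exists2 C : R, 0 <= C & forall (y : R -> R) (c : R), 0 <= c ->
  (exists m, forall t, 0 <= t <= T -> y t <= m) -> y 0 <= c ->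
  (forall s t m, 0 <= s -> s <= t -> t <= T -> t - s <= delta ->
    (forall u, s <= u <= t -> y u <= m) -> y t <= y s + c + m / 2) ->
  forall t, 0 <= t <= T -> y t <= C * c.
Proof.
move=> delta0.
pose K (n : nat) : R := iter n (fun a => 2 * (a + 1)) 1.
have K0 n : 0 <= K n by elim: n => [|n IH] /=; [exact: ler01|have := IH; rewrite /K; lra].
pose n := (Num.truncn (T / delta)).+1.
exists (K n) => // y c c0 [m0 ym0] y0c ystep.
have step s t : 0 <= s -> s <= t -> t <= T -> t - s <= delta -> y t <= 2 * (y s + c).
  move=> s0 st tT tsd.
  pose S := [set y u | u in `[s, t]].
  have Sub : has_ubound S.
    exists m0 => z [u]; rewrite /= in_itv/= => /andP[su ut] <-.
    by apply: ym0; rewrite (le_trans s0 su) (le_trans ut tT).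
  have inS u : s <= u <= t -> S (y u) by move=> sut; exists u; rewrite //= in_itv.
  have ySup u : s <= u <= t -> y u <= y s + c + sup S / 2.
    move=> /andP[su ut]; apply: (ystep s u (sup S)) => //.
    - exact: le_trans tT.
    - by lra.
    - move=> v /andP[sv vu]; apply: ub_le_sup => //; apply: inS.
      by rewrite sv (le_trans vu).
  have Sy : sup S <= y s + c + sup S / 2.
    apply: ge_sup; first by exists (y s); apply: inS; rewrite lexx.
    by move=> z [u /= ut <-]; apply: ySup; move: ut; rewrite in_itv.
  by have := ySup t; rewrite lexx st => /(_ isT); lra.
have main k t : 0 <= t <= T -> t <= k%:R * delta -> y t <= K k * c.
  elim: k t => [|k IH] t /andP[t0 tT].
    rewrite mul0r => t0'; have -> : t = 0 by apply/eqP; rewrite eq_le t0 t0'.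
    by rewrite mul1r.
  rewrite -natr1 mulrDl mul1r => tk.
  have [td|td] := leP t delta.
    have := step 0 t (lexx 0) t0 tT; rewrite subr0 => /(_ td) yt.
    have := IH 0; rewrite lexx (le_trans t0 tT) mulr_ge0 ?ler0n ?(ltW delta0)// => /(_ isT isT).
    by rewrite /=; lra.
  have := step (t - delta) t; rewrite subr_ge0 (ltW td) subKr lexx => /(_ isT _ tT isT) yt.
  have := IH (t - delta); rewrite subr_ge0 (ltW td)/= => H.
  have {}H : y (t - delta) <= K k * c by apply: H; lra.
  have : y t <= 2 * (y (t - delta) + c) by apply: yt; lra.
  by rewrite /=; lra.
move=> t tT; apply: main => //; case/andP: tT => _ tT.
apply: le_trans tT _; rewrite -ler_pdivrMr//.
by apply: ltW; exact: truncnS_gt.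
Qed.

(** * Completeness of the weighted space of square-integrable controls *)

Lemma limn_einf_le (R : realType) (u : nat -> \bar R) (c : \bar R) (K : nat) :
  (forall n, (K <= n)%N -> (u n <= c)%E) -> (limn_einf u <= c)%E.
Proof.
move=> uc; rewrite limn_einf_lim; apply: lime_le; first exact: is_cvg_einfs.
apply: nearW => n; apply: le_trans (uc (maxn K n) (leq_maxl _ _)).
by apply: ereal_inf_lbound; exists (maxn K n) => //=; exact: leq_maxr.
Qed.

Lemma cvg_quad (R : realType) n (P : 'M[R]_n) (u : nat -> 'cV[R]_n)
    (v : 'cV[R]_n) :
  (forall i, u k i 0 @[k --> \oo] --> v i 0) ->
  quad P (u k) (u k) @[k --> \oo] --> quad P v v.
Proof.
move=> uv.
have -> : (fun k => quad P (u k) (u k)) =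
    (fun k => \sum_i \sum_j u k i 0 * P i j * u k j 0).
  by apply/funext => k; rewrite quadE.
rewrite quadE; apply: cvg_big => [|i _]; first exact: add_continuous.
apply: cvg_big => [|j _]; first exact: add_continuous.
by apply: cvgM => //; apply: cvgMl; exact: uv.
Qed.

Section quad_complete.
Context d (X : measurableType d) (R : realType) (mu : {measure set X -> \bar R}).
Variables (D : set X) (M : nat) (P : X -> 'M[R]_M) (r : R).
Hypotheses (mD : measurable D) (r_gt0 : 0 < r).
Hypotheses (P_lb : forall t, D t -> psd (P t - r%:M)) (P_psd : forall t, D t -> psd (P t)).
Hypothesis (mP : measurable_mx D P).
Implicit Types (u v : X -> 'cV[R]_M).

(** Extended-valued, so that finiteness can be a hypothesis. *)
Definition energy u : \bar R := (\int[mu]_(t in D) (quad (P t) (u t) (u t))%:E)%E.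

Lemma measurable_energy u : measurable_mx D u ->
  measurable_fun D (fun t => (quad (P t) (u t) (u t))%:E).
Proof. by move=> u_meas; apply/measurable_EFinP; exact: measurable_quad. Qed.

Lemma measurable_subfun u v : measurable_mx D u -> measurable_mx D v ->
  measurable_mx D (fun t => u t - v t).
Proof.
move=> mu' mv; apply: measurable_addmx => // i j.
apply: (@eq_measurable_fun _ _ _ _ D (fun t => - v t i j)).
  by move=> t _; rewrite mxE.
exact: measurable_funN.
Qed.

(* Along a sequence with energy increments 4^-k 2^-(k+1), the increments
   weighted by 4^k are integrable, hence finite almost everywhere. *)
Section fast.
Variable W : nat -> X -> 'cV[R]_M.
Hypothesis mW : forall k, measurable_mx D (W k).
Let q k t := quad (P t) (W k.+1 t - W k t) (W k.+1 t - W k t).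
Hypothesis fastW : forall k,
  (energy (fun t => W k.+1 t - W k t)%R <= ((4 ^+ k)^-1 * (1 / (2 ^ k.+1)%:R))%:E)%E.

Let G t : \bar R := (\sum_(0 <= k <oo) (4 ^+ k * q k t)%:E)%E.

Let q_ge0 k t : D t -> 0 <= q k t.
Proof. by move=> Dt; exact: (P_psd Dt).2. Qed.

Let p_ge0 k t : D t -> (0 <= (4 ^+ k * q k t)%:E)%E.
Proof. by move=> Dt; rewrite lee_fin mulr_ge0 ?exprn_ge0 ?q_ge0. Qed.

Let mp k : measurable_fun D (fun t => (4 ^+ k * q k t)%:E).
Proof.
apply/measurable_EFinP; apply: measurable_funM => //.
by apply: measurable_quad => //; exact: measurable_subfun.
Qed.

Let mG : measurable_fun D G.
Proof.
apply: (emeasurable_fun_cvg (fun n t => \sum_(0 <= k < n) (4 ^+ k * q k t)%:E)%E).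
  by move=> n; exact: emeasurable_sum.
by move=> t Dt; apply: is_cvg_nneseries => n _ _; exact: p_ge0.
Qed.

Let G_ge0 t : D t -> (0 <= G t)%E.
Proof. by move=> Dt; apply: nneseries_ge0 => n _ _; exact: p_ge0. Qed.

Let intG : mu.-integrable D G.
Proof.
apply/integrableP; split=> //.
rewrite (eq_integral G); last by move=> t /set_mem Dt; rewrite gee0_abs// G_ge0.
rewrite integral_nneseries//.
apply: (@le_lt_trans _ _ 1%E); last exact: ltry.
apply: le_trans (epsilon_trick0 xpredT ler01); apply: lee_nneseries => k _.
  by move=> _; apply: integral_ge0 => t; exact: p_ge0.
under eq_integral do rewrite EFinM.
rewrite ge0_integralZl_EFin//=; last 2 first.
- by move=> t Dt; rewrite lee_fin q_ge0.
- by apply: measurable_energy; exact: measurable_subfun.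
have k4 : (0 < ((4 ^+ k)^-1)%:E :> \bar R)%E by rewrite lte_fin invr_gt0 exprn_gt0.
rewrite -(lee_pmul2l _ k4)// muleA -EFinM mulVf ?expf_neq0// mul1e -EFinM; exact: fastW.
Qed.

Let A := D `&` [set t | G t \is a fin_num].

Let mA : measurable A. Proof. exact: emeasurable_fin_num. Qed.

Let A0 : mu (D `\` A) = 0%E.
Proof.
have [Z [mZ Z0 ZS]] := integrable_ae mD intG.
apply: subset_measure0 Z0 => //; first exact: measurableD.
by move=> t [Dt nA]; apply: ZS => /= H; apply: nA; split => //; exact: H.
Qed.

Let cvgA t i : A t -> cvgn (fun k => W k t i 0).
Proof.
move=> [Dt Gfin].
pose c := Num.sqrt (r^-1 * fine (G t)).
have dle k : `|W k.+1 t i 0 - W k t i 0| <= geometric c 2^-1 k.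
  have qG : 4 ^+ k * q k t <= fine (G t).
    rewrite -lee_fin fineK//; apply: le_trans (@nneseries_lim_ge _ _ xpredT 0%N k.+1 _).
      rewrite big_nat_recr//= leeDr// sume_ge0// => j _; exact: p_ge0.
    by move=> j _ _; exact: p_ge0.
  have := psd_lb (W k.+1 t - W k t) (P_lb Dt); rewrite -/(q k t) => lb.
  have {}lb : r * (W k.+1 t i 0 - W k t i 0) ^+ 2 <= q k t.
    apply: le_trans lb; rewrite ler_pM2l// (bigD1 i)//= !mxE lerDl sumr_ge0// => j _.
    exact: sqr_ge0.
  rewrite -(@ler_pXn2r _ 2)// ?nnegrE ?normr_ge0//=; last first.
    by rewrite mulr_ge0 ?sqrtr_ge0// exprn_ge0// invr_ge0.
  have G0 : 0 <= fine (G t) by apply/fine_ge0/G_ge0.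
  rewrite real_normK ?num_real// exprMn sqr_sqrtr; last first.
    by rewrite mulr_ge0// invr_ge0 ltW.
  have -> : (2^-1 ^+ k) ^+ 2 = (4 ^+ k)^-1 :> R.
    by rewrite -exprM mulnC exprM -[RHS]exprVn; congr (_ ^+ _); field.
  rewrite -mulrA ler_pdivlMl// ler_pdivlMr ?exprn_gt0// mulrC.
  by apply: le_trans qG; rewrite ler_pM2l ?exprn_gt0.
have : cvgn (series (telescope (fun k => W k t i 0))).
  apply: normed_cvg; apply: (@series_le_cvg _ _ (geometric c 2^-1)) => //.
  - by move=> n; exact: normr_ge0.
  - by move=> n; apply: geometric_ge0; rewrite ?sqrtr_ge0 ?invr_ge0.
  - by apply: is_cvg_geometric_series; rewrite ger0_norm ?invr_ge0//; lra.
move=> H; rewrite (_ : (fun k => _) = (fun k => W 0%N t i 0 + series (telescope (fun k => W k t i 0)) k)).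
  by apply: is_cvgD => //; exact: is_cvg_cst.
by apply/funext => k; rewrite -(eq_sum_telescope (fun k => W k t i 0)).
Qed.

(** Summable increments make W converge almost everywhere, and Fatou's lemma
    transfers energy bounds to the limit. *)
Lemma fast_energy_limit : exists2 V, measurable_mx D V &
  forall u e K, measurable_mx D u ->
    (forall k, (K <= k)%N -> (energy (fun t => u t - W k t)%R <= e)%E) ->
    (energy (fun t => u t - V t)%R <= e)%E.
Proof.
pose V t : 'cV[R]_M := if t \in A then \col_i limn (fun k => W k t i 0) else 0.
have VA t i : A t -> W k t i 0 @[k --> \oo] --> V t i 0.
  by move=> At; rewrite /V mem_set// mxE; exact: cvgA.
have mV : measurable_mx D V.
  move=> i j; rewrite (ord1 j).
  apply: (@measurable_fun_cvg _ _ _ _ (fun k => (fun t => W k t i 0) \_ A)).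
    move=> k; apply/measurable_restrict => //.
    by apply: measurable_funS (mW k i 0) => // t [].
  move=> t _; have [At|nAt] := pselect (A t).
    by apply: cvg_trans (VA t i At); apply: near_eq_cvg; apply: nearW => k; rewrite patchE mem_set.
  rewrite /V memNset// mxE; apply: cvg_near_cst.
  by apply: nearW => k; rewrite patchE memNset.
exists V => // u e K u_meas ue.
have AD : A `<=` D by move=> t [].
have -> : energy (fun t => u t - V t) =
   (\int[mu]_(t in A) (quad (P t) (u t - V t) (u t - V t))%:E)%E.
  rewrite /energy (@ge0_negligible_integral _ _ _ mu D (D `\` A))//.
  - by rewrite setDD (setIidr AD).
  - exact: measurableD.
  - by apply: measurable_energy; exact: measurable_subfun.
  - by move=> t Dt; rewrite lee_fin; exact: (P_psd Dt).2.
pose h k t := (quad (P t) (u t - W k t) (u t - W k t))%:E.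
have mh k : measurable_fun D (h k) by apply: measurable_energy; exact: measurable_subfun.
have h0 k t : D t -> (0 <= h k t)%E.
  by move=> Dt; rewrite lee_fin; exact: (P_psd Dt).2.
rewrite (eq_integral (fun t => limn_einf (h ^~ t))); last first.
  move=> t /set_mem At; have := @cvg_limn_einf_sup _ (h ^~ t) (quad (P t) (u t - V t) (u t - V t))%:E.
  move=> H; rewrite (H _).1//; apply: cvg_EFin; first exact: nearW.
  apply: cvg_quad => i; rewrite !mxE.
  rewrite (_ : (fun k => _) = (fun k => u t i 0 - W k t i 0)); last first.
    by apply/funext => k; rewrite !mxE.
  by apply: cvgB; [exact: cvg_cst|exact: VA].
apply: le_trans (fatou _ _ _ _) _ => //.
- by move=> k; apply: measurable_funS (mh k).
- by move=> k t /AD; exact: h0.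
apply: (limn_einf_le (K := K)) => k Kk; apply: le_trans (ue k Kk).
by apply: ge0_subset_integral => // t; exact: h0.
Qed.

End fast.

(** As for the completeness of L^2: a subsequence with fast decreasing increments
    has a limit, to which the Cauchy property draws the whole sequence. *)
Theorem energy_complete (U : nat -> X -> 'cV[R]_M) : (forall n, measurable_mx D (U n)) ->
  (forall e : R, 0 < e -> exists n0, forall m n, (n0 <= m)%N -> (n0 <= n)%N ->
     (energy (fun t => U m t - U n t)%R <= e%:E)%E) ->
  exists2 V, measurable_mx D V &
  forall e : R, 0 < e -> exists n0, forall n, (n0 <= n)%N ->
     (energy (fun t => U n t - V t)%R <= e%:E)%E.
Proof.
move=> mU cauchyU.
pose eps k : R := (4 ^+ k)^-1 * (1 / (2 ^ k.+1)%:R).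
have eps0 k : 0 < eps k by rewrite mulr_gt0 ?invr_gt0 ?exprn_gt0// divr_gt0 ?ltr0n ?expn_gt0.
have /choice[nn nnP] := fun k => cauchyU (eps k) (eps0 k).
(* dominates nn k, and k, and is nondecreasing *)
pose n_ k := (\sum_(j < k.+1) (nn j).+1)%N.
have n_ge k : (nn k <= n_ k)%N by rewrite /n_ big_ord_recr/= addnS ltnW// ltnS leq_addl.
have n_S k : (n_ k <= n_ k.+1)%N by rewrite {2}/n_ big_ord_recr/= leq_addr.
have [//||V mV VP] := @fast_energy_limit (fun k => U (n_ k)).
  by move=> k; apply: nnP => //; exact: leq_trans (n_S k).
exists V => // e e0; have [n0 Hn0] := cauchyU e e0.
exists n0 => n nn0; apply: (VP _ _ n0) => // k n0k; apply: Hn0 => //.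
apply: leq_trans (leq_trans n0k (leqnSn k)) _.
rewrite /n_ -[X in (X <= _)%N]card_ord -sum1_card.
exact: leq_sum.
Qed.

End quad_complete.

(** * Entrywise norms *)

Section entrywise_norms.
Variable R : realType.

Definition norm1 n (v : 'cV[R]_n) : R := \sum_i `|v i 0|.
Definition mxsum m n (A : 'M[R]_(m, n)) : R := \sum_i \sum_j `|A i j|.
Definition mxsq m n (A : 'M[R]_(m, n)) : R := \sum_i \sum_j A i j ^+ 2.
Definition sumsq n (v : 'cV[R]_n) : R := \sum_i v i 0 ^+ 2.

Lemma norm1_ge0 n (v : 'cV[R]_n) : 0 <= norm1 v.
Proof. by apply: sumr_ge0. Qed.

Lemma mxsum_ge0 m n (A : 'M[R]_(m, n)) : 0 <= mxsum A.
Proof. by apply: sumr_ge0 => i _; apply: sumr_ge0. Qed.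

Lemma mxsq_ge0 m n (A : 'M[R]_(m, n)) : 0 <= mxsq A.
Proof. by apply: sumr_ge0 => i _; apply: sumr_ge0 => j _; exact: sqr_ge0. Qed.

Lemma sumsq_ge0 n (v : 'cV[R]_n) : 0 <= sumsq v.
Proof. by apply: sumr_ge0 => i _; exact: sqr_ge0. Qed.

Lemma norm1_coord n (v : 'cV[R]_n) i : `|v i 0| <= norm1 v.
Proof. by rewrite /norm1 (bigD1 i)//= lerDl sumr_ge0. Qed.

Lemma norm1D n (u v : 'cV[R]_n) : norm1 (u + v) <= norm1 u + norm1 v.
Proof. by rewrite -big_split/=; apply: ler_sum => i _; rewrite mxE ler_normD. Qed.

Lemma norm1N n (u : 'cV[R]_n) : norm1 (- u) = norm1 u.
Proof. by apply: eq_bigr => i _; rewrite mxE normrN. Qed.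

Lemma norm1Z n a (u : 'cV[R]_n) : norm1 (a *: u) = `|a| * norm1 u.
Proof. by rewrite mulr_sumr; apply: eq_bigr => i _; rewrite mxE normrM. Qed.

Lemma norm1_eq0 n (u : 'cV[R]_n) : norm1 u <= 0 -> u = 0.
Proof.
move=> u0; apply/colP => i; rewrite mxE; apply/eqP; rewrite -normr_le0.
exact: le_trans (norm1_coord u i) u0.
Qed.

Lemma norm1_mulmx m n (A : 'M[R]_(m, n)) v : norm1 (A *m v) <= mxsum A * norm1 v.
Proof.
rewrite mulr_suml; apply: ler_sum => i _; rewrite mxE mulr_suml.
apply: le_trans (ler_norm_sum _ _ _) _; apply: ler_sum => j _.
by rewrite normrM ler_wpM2l// norm1_coord.
Qed.

(** By 2bc <= k b^2 + c^2 / k.  The parameter k is free, so that the share of B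
    can be made small while the energy of u goes to zero: this stands for the
    Cauchy-Schwarz inequality for integrals. *)
Lemma norm1_mulmx_sq m n (B : 'M[R]_(m, n)) u k : 0 < k ->
  norm1 (B *m u) <= k * mxsq B + k^-1 * (m%:R * sumsq u).
Proof.
move=> k0; have -> : m%:R * sumsq u = \sum_(i < m) sumsq u.
  by rewrite sumr_const card_ord mulr_natl.
rewrite !mulr_sumr -big_split/=; apply: ler_sum => i _; rewrite mxE.
apply: le_trans (ler_norm_sum _ _ _) _.
rewrite !mulr_sumr -big_split/=; apply: ler_sum => j _; rewrite normrM.
rewrite -(real_normK (num_real (B i j))) -(real_normK (num_real (u j 0))).
move: `|B i j| `|u j 0| (normr_ge0 (B i j)) (normr_ge0 (u j 0)) => b c b0 c0.
have -> : k * b ^+ 2 + k^-1 * c ^+ 2 = k * (b - k^-1 * c) ^+ 2 + 2 * (b * c).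
  by field; rewrite gt_eqF.
have := mulr_ge0 (ltW k0) (sqr_ge0 (b - k^-1 * c)); have := mulr_ge0 b0 c0; lra.
Qed.

Lemma norm1_sumsq n (v : 'cV[R]_n) : norm1 v <= n%:R + sumsq v.
Proof.
have -> : n%:R = \sum_(i < n) 1 :> R by rewrite sumr_const card_ord.
rewrite -big_split/=; apply: ler_sum => i _.
by rewrite -(real_normK (num_real (v i 0))); have := sqr_ge0 (`|v i 0| - 1); nra.
Qed.

Lemma sumsq_norm1 n (v : 'cV[R]_n) : sumsq v <= norm1 v ^+ 2.
Proof.
rewrite expr2 {1}/norm1 mulr_suml; apply: ler_sum => i _.
by rewrite -(real_normK (num_real (v i 0))) expr2 ler_wpM2l// norm1_coord.
Qed.

Lemma quad_mxsum n (P : 'M[R]_n) u v : `|quad P u v| <= mxsum P * (norm1 u * norm1 v).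
Proof.
rewrite quadE; apply: le_trans (ler_norm_sum _ _ _) _.
rewrite mulr_suml; apply: ler_sum => i _; rewrite mulr_suml.
apply: le_trans (ler_norm_sum _ _ _) _; apply: ler_sum => j _.
rewrite !normrM mulrAC mulrC ler_wpM2l// ler_pM// ?mulr_ge0 ?norm1_coord//.
Qed.

End entrywise_norms.

(** * Integrable functions on [0, T] *)

Section integrable_on.
Context d (X : measurableType d) (R : realType) (mu : {measure set X -> \bar R}).
Variable D : set X.
Hypothesis mD : measurable D.
Implicit Types f g : X -> R.
Local Notation intD f := (mu.-integrable D (EFin \o f)).

Lemma integrable_dominated f g : measurable_fun D f -> (forall t, D t -> `|f t| <= g t) ->
  intD g -> intD f.
Proof.
move=> mf fg; apply: le_integrable => //; first exact/measurable_EFinP.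
move=> t Dt; rewrite /= lee_fin; apply: le_trans (fg t Dt) _; exact: ler_norm.
Qed.

Lemma integrable_add f g : intD f -> intD g -> intD (fun t => f t + g t).
Proof. by move=> iF ig; apply: (integrableD mD iF ig). Qed.

Lemma integrable_sub_fun f g : intD f -> intD g -> intD (fun t => f t - g t).
Proof. by move=> iF ig; apply: (integrableB mD iF ig). Qed.

Lemma integrable_scale k f : intD f -> intD (fun t => k * f t).
Proof. by move=> iF; apply: (integrableZl mD k iF). Qed.

Lemma integrable_sum_fun I (s : seq I) (f : I -> X -> R) :
  (forall i, intD (f i)) -> intD (fun t => \sum_(i <- s) f i t).
Proof.
move=> fi; have := @integrable_sum _ _ _ mu D mD _ s xpredT (fun i => EFin \o f i) (fun i _ => fi i).
by apply: eq_integrable => // t _; rewrite /= sumEFin.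
Qed.

Lemma integrable_normr f : intD f -> intD (fun t => `|f t|).
Proof. exact: integrable_norm. Qed.

Lemma ge0_integrable f : measurable_fun D f -> (forall t, D t -> 0 <= f t) ->
  (\int[mu]_(t in D) (f t)%:E < +oo)%E -> intD f.
Proof.
move=> mf f0 iF; apply/integrableP; split; first exact/measurable_EFinP.
rewrite (eq_integral (fun t => (f t)%:E))// => t /set_mem Dt.
by rewrite gee0_abs// lee_fin f0.
Qed.

Lemma Rintegral_sum I (s : seq I) (f : I -> X -> R) : (forall i, intD (f i)) ->
  \int[mu]_(t in D) (\sum_(i <- s) f i t) = \sum_(i <- s) \int[mu]_(t in D) f i t.
Proof.
move=> fi; elim: s => [|i s IH].
  rewrite big_nil (@eq_Rintegral _ _ _ _ _ (cst 0)); last by move=> t _; rewrite big_nil.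
  by rewrite /Rintegral integral0.
rewrite big_cons -IH -RintegralD//; last exact: integrable_sum_fun.
by apply: eq_Rintegral => t _; rewrite big_cons.
Qed.

End integrable_on.

(** * Paths on [0, T] *)

Section paths.
Variables (R : realType) (T : R) (N : nat).
Hypothesis T_gt0 : 0 < T.
Local Notation mu := (@lebesgue_measure R).
Implicit Types x y : seg T -> 'cV[R]_N.

Lemma ext_seg x t (tT : 0 <= t <= T) : ext x t = x (exist _ t tT).
Proof.
rewrite /ext; case: insubP => [u _ ut|]; last by rewrite tT.
by rewrite /=; congr x; apply: val_inj.
Qed.

Lemma ext_val x (s : seg T) : ext x (val s) = x s.
Proof. by rewrite ext_seg; [exact: (valP s)|move=> ?; congr x; exact: val_inj]. Qed.

Lemma ext_lin a x y : ext (a *: x + y) = (fun t => a *: ext x t + ext y t).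
Proof.
apply/funext => t; have [tT|tT] := boolP (0 <= t <= T).
  by rewrite !ext_seg.
by rewrite /ext !insubN//= scaler0 addr0.
Qed.

Lemma ext0 : ext (0 : seg T -> 'cV[R]_N) = fun=> 0.
Proof.
by apply/funext => t; rewrite /ext; case: insubP.
Qed.

(** The norm of a column vector is the maximum of its entries, so absolute
    continuity can be checked coordinatewise. *)
Lemma abs_continuous_coord x i : abs_continuous x -> abs_cont T (fun t => ext x t i 0).
Proof.
move=> xac e /xac[d d0 xd]; exists d => // n a b ab tab sd.
have aT j : 0 <= a j <= T by have [? ? ?] := ab j; apply/andP; split => //; lra.
have bT j : 0 <= b j <= T by have [? ? ?] := ab j; apply/andP; split => //; lra.
pose a' j : seg T := exist _ (a j) (aT j); pose b' j : seg T := exist _ (b j) (bT j).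
have ab' j : val (a' j) <= val (b' j) by case: (ab j).
apply: le_lt_trans (xd n a' b' ab' tab sd).
  apply: ler_sum => j _; rewrite (ext_seg x (aT j)) (ext_seg x (bT j)).
  move: (x _) (x _) => u v.
  have -> : v i 0 - u i 0 = (v - u) i 0 by rewrite !mxE.
  rewrite [leRHS]mx_normrE.
  by apply: (@le_bigmax _ _ _ _ (fun ij => `|(v - u) ij.1 ij.2|) (i, 0)).
Qed.

Lemma coord_abs_continuous x : (forall i, abs_cont T (fun t => ext x t i 0)) -> abs_continuous x.
Proof.
move=> xac e e0.
have eN0 : 0 < e / N.+1%:R by rewrite divr_gt0.
have /choice[d dP] : forall i : 'I_N, exists d, 0 < d /\ forall n (a b : 'I_n -> R),
    (forall i, [/\ 0 <= a i, a i <= b i & b i <= T]) ->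
    trivIset [set: 'I_n] (fun i => `]a i, b i[%classic) ->
    \sum_(i < n) (b i - a i) < d ->
    \sum_(j < n) `|ext x (b j) i 0 - ext x (a j) i 0| < e / N.+1%:R.
  by move=> i; have [d d0 H] := xac i _ eN0; exists d.
exists (\big[Num.min/1]_i d i).
  by apply: lt_bigmin => // i _; have [] := dP i.
move=> n a b ab tab sd.
apply: (@le_lt_trans _ _ (\sum_(j < n) \sum_i `|ext x (val (b j)) i 0 - ext x (val (a j)) i 0|)).
  apply: ler_sum => j _; under eq_bigr do rewrite !ext_val.
  rewrite [leLHS]mx_normrE.
  apply: bigmax_le => [|[i k] _]; first exact: sumr_ge0.
  by rewrite /= (ord1 k) !mxE (bigD1 i)//= lerDl sumr_ge0.
rewrite exchange_big/=; apply: (@le_lt_trans _ _ (\sum_(i < N) e / N.+1%:R)).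
  apply: ler_sum => i _; apply: ltW; apply: (dP i).2 => //.
    move=> j; split; [by case/andP: (valP (a j))| exact: ab| by case/andP: (valP (b j))].
  by apply: lt_le_trans sd _; exact: bigmin_le.
rewrite sumr_const card_ord -[ltLHS]mulr_natl mulrCA gtr_pMr//.
by rewrite ltr_pdivrMr// mul1r ltr_nat.
Qed.

Lemma abs_cont_continuous (f : R -> R) : abs_cont T f -> {within `[0, T], continuous f}.
Proof.
move=> fT; apply/continuous_within_itvP => //.
have tr (F : 'I_1 -> set R) : trivIset [set: 'I_1] F.
  by apply/trivIsetP => i j _ _; rewrite (ord1 i) (ord1 j) eqxx.
have near_close (t : R) (e : R) : 0 <= t <= T -> 0 < e -> exists2 d, 0 < d &
    forall s, 0 <= s <= T -> `|t - s| < d -> `|f t - f s| < e.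
  move=> /andP[t0 tT] /fT[d d0 fd]; exists d => // s /andP[s0 sT] ts.
  have := fd 1%N (fun=> Num.min s t) (fun=> Num.max s t).
  rewrite !big_ord1; have [st|ts'] := leP s t.
    by move=> H; apply: H => //; rewrite ger0_norm ?subr_ge0 in ts.
  rewrite distrC => H; apply: H => //.
    by move=> i; split => //; exact: ltW.
  by move: ts; rewrite distrC ger0_norm ?subr_ge0// ltW.
split.
- move=> t; rewrite in_itv/= => /andP[t0 tT].
  apply/cvgrPdist_lt => e e0.
  have [|d d0 H] := near_close t e _ e0; first by rewrite !ltW.
  near=> s; apply: H; last by near: s; exists d.
  apply/andP; split; apply: ltW; near: s; [exact: lt_nbhsr|exact: lt_nbhsl].
- apply/cvgrPdist_lt => e e0.
  have [|d d0 H] := near_close 0 e _ e0; first by rewrite lexx ltW.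
  near=> s; have s0 : 0 < s by near: s; exact: nbhs_right_gt.
  apply: H; last by rewrite sub0r normrN gtr0_norm//; near: s; exact: nbhs_right_lt.
  by rewrite (ltW s0) ltW//; near: s; exact: nbhs_right_lt.
- apply/cvgrPdist_lt => e e0.
  have [|d d0 H] := near_close T e _ e0; first by rewrite lexx ltW.
  near=> s; have sT : s < T by near: s; exact: nbhs_left_lt.
  apply: H; last by rewrite gtr0_norm ?subr_gt0//; near: s; exact: nbhs_left_ltBl.
  by rewrite (ltW sT) andbT ltW//; near: s; exact: nbhs_left_gt.
Unshelve. all: by end_near. Qed.

Lemma abs_cont_measurable (f : R -> R) : abs_cont T f -> measurable_fun `[0, T] f.
Proof. by move=> /abs_cont_continuous; exact: subspace_continuous_measurable_fun. Qed.

Lemma abs_cont_bounded (f : R -> R) : abs_cont T f ->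
  exists m, forall t, 0 <= t <= T -> `|f t| <= m.
Proof.
move=> /abs_cont_continuous cf.
have cnf : {within `[0, T], continuous (fun t => `|f t|)}.
  by move=> t; apply: continuous_comp; [exact: cf|exact: norm_continuous].
have [c _ cP] := EVT_max (ltW T_gt0) cnf.
by exists `|f c| => t tT; apply: cP; rewrite in_itv.
Qed.

Lemma is_derive_coord x (t : R) (g : 'cV[R]_N) : is_derive t 1 (ext x) g ->
  forall i, is_derive t 1 (fun s : R => ext x s i 0) (g i 0).
Proof.
move=> [dx gE] i; apply: DeriveDef.
  by have /derivable_mxP := dx; apply.
by rewrite -gE derive_mx// mxE.
Qed.

Lemma coord_is_derive x (t : R) (g : 'cV[R]_N) :
  (forall i, is_derive t 1 (fun s : R => ext x s i 0) (g i 0)) -> is_derive t 1 (ext x) g.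
Proof.
move=> H; have dx : derivable (ext x) t 1.
  by apply/derivable_mxP => i j; rewrite (ord1 j); case: (H i).
by apply: DeriveDef => //; apply/colP => i; rewrite derive_mx// mxE; case: (H i).
Qed.

End paths.

(** * Trajectories of the control system *)

Section Lp_entries.
Variables (R : realType) (T : R) (m n : nat) (F : R -> 'M[R]_(m, n)).
Local Notation mu := (@lebesgue_measure R).

Lemma Lp_mx_measurable p : Lp_mx T p F -> measurable_mx (`[0, T]%classic : set (measurableTypeR R)) F.
Proof.
move=> FL i j; have := FL i j; rewrite inE => /andP[+ _]; rewrite inE/= => H.
exact/(measurable_restrictT (fun t => F t i j)).
Qed.

Lemma L1_integrable i j : Lp_mx T 1 F -> mu.-integrable `[0, T] (EFin \o (fun t => F t i j)).
Proof.
move=> /(_ i j)/Lfun1_integrable; rewrite -restrict_EFin => H.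
exact/integrable_mkcond.
Qed.

Lemma L2_integrable i j : Lp_mx T 2 F ->
  mu.-integrable `[0, T] (EFin \o (fun t => F t i j ^+ 2)).
Proof.
move=> /(_ i j)/Lfun2_integrable_sqr H; apply/integrable_mkcond => //.
apply: eq_integrable H => // t _; rewrite /= !patchE.
by case: ifP => //=; rewrite expr0n.
Qed.

Lemma L1_mxsum : Lp_mx T 1 F -> mu.-integrable `[0, T] (EFin \o (fun t => mxsum (F t))).
Proof.
move=> FL; apply: integrable_sum_fun => // i; apply: integrable_sum_fun => // j.
by apply: integrable_normr => //; exact: L1_integrable.
Qed.

Lemma L2_mxsq : Lp_mx T 2 F -> mu.-integrable `[0, T] (EFin \o (fun t => mxsq (F t))).
Proof.
move=> FL; apply: integrable_sum_fun => // i; apply: integrable_sum_fun => // j.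
exact: L2_integrable.
Qed.

End Lp_entries.

Section trajectory.
Variables (R : realType) (T : R) (N M : nat)
    (A : R -> 'M[R]_N) (B : R -> 'M[R]_(N, M))
    (Q : R -> 'M[R]_N) (Rw : R -> 'M[R]_M) (r : R).
Hypotheses (T_gt0 : 0 < T)
    (Q_psd : forall t : R, 0 <= t <= T -> psd (Q t))
    (Rw_psd : forall t : R, 0 <= t <= T -> psd (Rw t))
    (A_L1 : Lp_mx T 1 A) (B_L2 : Lp_mx T 2 B)
    (Q_L1 : Lp_mx T 1 Q) (Rw_L2 : Lp_mx T 2 Rw) (r_gt0 : 0 < r)
    (Rw_lb : forall t : R, 0 <= t <= T -> psd (Rw t - r%:M)).
Local Notation mu := (@lebesgue_measure R).
Local Notation D := (`[0, T]%classic : set (measurableTypeR R)).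
Local Notation intD f := (mu.-integrable D (EFin \o f)).
Implicit Types (x y : seg T -> 'cV[R]_N) (u v : R -> 'cV[R]_M) (z : R -> 'cV[R]_N).

Lemma in_D t : D t = (0 <= t <= T) :> Prop.
Proof. by rewrite /= in_itv. Qed.

Let mD : measurable D. Proof. exact: measurable_itv. Qed.
Let mA := Lp_mx_measurable A_L1.
Let mB := Lp_mx_measurable B_L2.
Let mQ := Lp_mx_measurable Q_L1.
Let mRw := Lp_mx_measurable Rw_L2.
Let iA := L1_mxsum A_L1.
Let iB := L2_mxsq B_L2.
Let iQ := L1_mxsum Q_L1.
Let Rw_psdD t : D t -> psd (Rw t). Proof. by rewrite in_D; exact: Rw_psd. Qed.
Let Rw_lbD t : D t -> psd (Rw t - r%:M). Proof. by rewrite in_D; exact: Rw_lb. Qed.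

Definition cost u := \int[mu]_(t in D) quad (Rw t) (u t) (u t).

Lemma cost_ge0 u : 0 <= cost u.
Proof. by apply: Rintegral_ge0 => t /Rw_psdD[_]; apply. Qed.

Lemma energyE u : (energy mu D Rw u < +oo)%E -> energy mu D Rw u = (cost u)%:E.
Proof.
move=> uoo; rewrite /cost /Rintegral -/(energy mu D Rw u) fineK// ge0_fin_numE//.
by apply: integral_ge0 => t /Rw_psdD[_ /(_ (u t))]; rewrite lee_fin.
Qed.

Section finite_energy.
Variable u : R -> 'cV[R]_M.
Hypotheses (u_meas : measurable_mx D u) (u_fin : (energy mu D Rw u < +oo)%E).

Lemma integrable_quad : intD (fun t => quad (Rw t) (u t) (u t)).
Proof.
apply: ge0_integrable => //; first exact: measurable_quad.
by move=> t /Rw_psdD[_]; apply.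
Qed.

Let sumsq_lb t : D t -> sumsq (u t) <= r^-1 * quad (Rw t) (u t) (u t).
Proof. by move=> /Rw_lbD /(psd_lb (u t)) H; rewrite ler_pdivlMl. Qed.

Lemma integrable_sumsq : intD (fun t => sumsq (u t)).
Proof.
apply: (integrable_dominated mD _ _ (integrable_scale mD r^-1 integrable_quad)) => //.
  by apply: measurable_sum => i; apply: measurable_funX; exact: u_meas.
by move=> t Dt; rewrite ger0_norm ?sumsq_ge0// sumsq_lb.
Qed.

Lemma sumsq_cost : \int[mu]_(t in D) sumsq (u t) <= r^-1 * cost u.
Proof.
rewrite /cost -RintegralZl//; last exact: integrable_quad.
apply: le_Rintegral => //; first exact: integrable_sumsq.
by apply: integrable_scale => //; exact: integrable_quad.
Qed.

Lemma measurable_norm1 n (w : R -> 'cV[R]_n) : measurable_mx D w ->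
  measurable_fun D (fun t => norm1 (w t)).
Proof.
by move=> mw; apply: measurable_sum => i; apply: measurableT_comp => //; exact: mw.
Qed.

Lemma integrable_norm1_Bu : intD (fun t => norm1 (B t *m u t)).
Proof.
apply: (@integrable_dominated _ _ _ mu _ mD _ (fun t => 1 * mxsq (B t) + 1^-1 * (N%:R * sumsq (u t)))).
- by apply: measurable_norm1; exact: measurable_mulmx.
- by move=> t Dt; rewrite ger0_norm ?norm1_ge0// norm1_mulmx_sq.
by do 2?apply: integrable_add => //; do ?[apply: integrable_scale => //]; exact: integrable_sumsq.
Qed.

(** Integrate [norm1_mulmx_sq]; by coercivity the cost dominates |u|^2. *)
Lemma norm1_Bu_le k : 0 < k ->
  \int[mu]_(t in D) norm1 (B t *m u t) <=
  k * \int[mu]_(t in D) mxsq (B t) + k^-1 * (N%:R * (r^-1 * cost u)).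
Proof.
move=> k0; apply: (@le_trans _ _ (\int[mu]_(t in D) (k * mxsq (B t) + k^-1 * (N%:R * sumsq (u t))))).
  apply: le_Rintegral => //; first exact: integrable_norm1_Bu.
    apply: integrable_add => //; apply: integrable_scale => //; apply: integrable_scale => //.
    exact: integrable_sumsq.
  by move=> t _; exact: norm1_mulmx_sq.
have iS := integrable_sumsq; have iNS := integrable_scale mD N%:R iS.
rewrite RintegralD//; [|exact: integrable_scale|exact: integrable_scale].
rewrite !RintegralZl// lerD2l ler_wpM2l ?invr_ge0 ?(ltW k0)//.
by rewrite ler_wpM2l// sumsq_cost.
Qed.

Definition rhs z u t := A t *m z t + B t *m u t.

Lemma integrable_rhs z m : measurable_mx D z -> (forall t, D t -> norm1 (z t) <= m) ->
  intD (fun t => norm1 (rhs z u t)) /\ forall i, intD (fun t => rhs z u t i 0).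
Proof.
move=> mz zm.
have mrhs : measurable_mx D (rhs z u).
  by apply: (measurable_addmx (measurable_mulmx mA mz) (measurable_mulmx mB u_meas)).
have i1 : intD (fun t => norm1 (rhs z u t)).
  apply: (@integrable_dominated _ _ _ mu _ mD _ (fun t => m * mxsum (A t) + norm1 (B t *m u t))).
  - exact: measurable_norm1.
  - move=> t Dt; rewrite ger0_norm ?norm1_ge0//; apply: le_trans (norm1D _ _) _.
    rewrite lerD2r; apply: le_trans (norm1_mulmx _ _) _.
    by rewrite mulrC ler_wpM2r ?mxsum_ge0// zm.
  - by apply: integrable_add => //; [exact: integrable_scale|exact: integrable_norm1_Bu].
split=> // i; refine (integrable_dominated mD (mrhs i 0) _ i1).
by move=> t _; exact: norm1_coord.
Qed.

End finite_energy.

(** The control is part of the data and need not be the minimal one: limits of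
    minimal controls are handled before their minimality is known. *)
Definition sol x u := [/\ abs_continuous x, measurable_mx D u,
  {ae mu, forall t : R, 0 <= t <= T -> is_derive t 1 (ext x) (rhs (ext x) u t)} &
  (energy mu D Rw u < +oo)%E].

Lemma path_measurable x : abs_continuous x -> measurable_mx D (ext x).
Proof.
by move=> xac i j; rewrite (ord1 j); exact: (abs_cont_measurable T_gt0 (abs_continuous_coord i xac)).
Qed.

Lemma path_bounded x : abs_continuous x -> exists m, forall t, D t -> norm1 (ext x t) <= m.
Proof.
move=> xac; have /choice[m mP] := fun i => abs_cont_bounded T_gt0 (abs_continuous_coord i xac).
by exists (\sum_i m i) => t; rewrite in_D => tT; apply: ler_sum => i _; exact: mP.
Qed.

Lemma sol_integrable x u : sol x u -> intD (fun t => norm1 (rhs (ext x) u t)) /\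
  forall i, intD (fun t => rhs (ext x) u t i 0).
Proof.
move=> [xac u_meas _ ufin]; have [m xm] := path_bounded xac.
by apply: integrable_rhs xm => //; exact: path_measurable.
Qed.

Lemma sol_integral x u t i : sol x u -> 0 <= t <= T ->
  ext x t i 0 = ext x 0 i 0 + primitive (fun s => rhs (ext x) u s i 0) t.
Proof.
move=> xu tT; have [_ /(_ i) ii] := sol_integrable xu; case: xu => xac _ xd _.
apply: (abs_cont_primitive ii (ltW T_gt0) (abs_continuous_coord i xac)) => //.
by apply: filterS xd => s /[apply] /is_derive_coord.
Qed.

Lemma subset_ocD s t : 0 <= s -> t <= T -> `]s, t]%classic `<=` D.
Proof. by move=> s0 tT; apply: subset_itv; rewrite bnd_simp. Qed.

(** The integral form of the state equation between s and t, with |x| replaced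
    by its bound m in the term A x. *)
Lemma sol_step x u s t m : sol x u -> 0 <= s -> s <= t -> t <= T ->
  (forall w, s <= w <= t -> norm1 (ext x w) <= m) ->
  norm1 (ext x t) <= norm1 (ext x s) + \int[mu]_(w in D) norm1 (B w *m u w) +
    m * \int[mu]_(w in `]s, t]) mxsum (A w).
Proof.
move=> xu s0 st tT xm; have [i1 ii] := sol_integrable xu.
have [xac u_meas _ ufin] := xu.
have stD := subset_ocD s0 tT.
have sub f : intD f -> mu.-integrable `]s, t] (EFin \o f) by apply: integrableS.
have iBu := integrable_norm1_Bu u_meas ufin.
have tD : 0 <= t <= T by rewrite (le_trans s0).
have sD : 0 <= s <= T by rewrite s0 (le_trans st).
have E i : `|ext x t i 0 - ext x s i 0| <= \int[mu]_(w in `]s, t]) `|rhs (ext x) u w i 0|.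
  rewrite (sol_integral i xu tD) (sol_integral i xu sD) opprD addrACA subrr add0r.
  exact: primitiveB_le.
have : norm1 (ext x t) <= norm1 (ext x s) + norm1 (ext x t - ext x s).
  by rewrite -[X in norm1 X <= _](subrK (ext x s)) [leRHS]addrC norm1D.
move=> H; apply: le_trans H _; rewrite -addrA lerD2l.
apply: (@le_trans _ _ (\int[mu]_(w in `]s, t]) norm1 (rhs (ext x) u w))).
  rewrite Rintegral_sum//; last by move=> i; apply: integrable_normr => //; exact: sub.
  by apply: ler_sum => i _; rewrite !mxE; exact: E.
apply: (@le_trans _ _ (\int[mu]_(w in `]s, t]) (norm1 (B w *m u w) + m * mxsum (A w)))).
  apply: le_Rintegral => //; first exact: sub.
    by apply: sub; apply: integrable_add => //; exact: integrable_scale.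
  move=> w; rewrite /= in_itv/= => /andP[sw wt]; rewrite addrC.
  apply: le_trans (norm1D _ _) _; rewrite lerD2r.
  apply: le_trans (norm1_mulmx _ _) _; rewrite mulrC ler_wpM2r ?mxsum_ge0//.
  by apply: xm; rewrite (ltW sw).
rewrite RintegralD//; [|exact: sub|by apply: integrable_scale => //; exact: sub].
rewrite RintegralZl//; last exact: sub.
rewrite lerD2r /Rintegral fine_le ?integrable_fin_num//; first exact: sub.
apply: ge0_subset_integral => //.
- by case/integrableP : iBu.
- by move=> w _; rewrite lee_fin norm1_ge0.
Qed.

(** The hypotheses define a set that contains the unit ball of the form.  The
    bound comes from a subdivision of [0, T] into intervals over which the
    integral of |A| is less than 1/2. *)
Lemma sol_bounded : exists2 C, 0 <= C & forall x u, sol x u ->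
  sumsq (ext x 0) <= 1 -> cost u <= 1 -> forall t, 0 <= t <= T -> norm1 (ext x t) <= C.
Proof.
have h0 : 0 < 2^-1 :> R by rewrite invr_gt0.
have [delta delta0 Hdelta] := integral_small iA h0.
have [//|K K0 HK] := @gronwall_subdivision R T (delta / 2); first by rewrite divr_gt0.
pose c := (N%:R + 1) + (\int[mu]_(t in D) mxsq (B t) + N%:R * r^-1).
have b0 : 0 <= \int[mu]_(t in D) mxsq (B t).
  by apply: Rintegral_ge0 => t _; exact: mxsq_ge0.
have Nr0 : 0 <= N%:R * r^-1 by rewrite mulr_ge0// invr_ge0 ltW.
have N0 : 0 <= N%:R :> R by [].
have c_ge0 : 0 <= c by rewrite !addr_ge0.
exists (K * c); first exact: mulr_ge0.
move=> x u xu x0 u1; have [xac u_meas _ ufin] := xu.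
have Bu : \int[mu]_(t in D) norm1 (B t *m u t) <= c.
  apply: le_trans (norm1_Bu_le u_meas ufin ltr01) _; rewrite invr1 !mul1r mulrA.
  rewrite /c [leRHS]addrC -[leLHS]addr0 lerD ?addr_ge0//.
  by rewrite lerD2l -[leRHS]mulr1 ler_wpM2l.
apply: HK.
- exact: c_ge0.
- by have [m xm] := path_bounded xac; exists m => t; rewrite -in_D; exact: xm.
- by apply: le_trans (norm1_sumsq _) _; rewrite -[leLHS]addr0 lerD ?addr_ge0// lerD2l.
move=> s t m s0 st tT tsd xm.
apply: le_trans (sol_step xu s0 st tT xm) _; apply: lerD; first by rewrite lerD2l.
have m0 : 0 <= m by apply: le_trans (norm1_ge0 _) (xm s _); rewrite lexx.
rewrite ler_wpM2l//; apply: ltW.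
rewrite (@eq_Rintegral _ _ _ _ _ (fun w : measurableTypeR R => `|mxsum (A w)|)); last first.
  by move=> w _; rewrite ger0_norm ?mxsum_ge0.
apply: Hdelta => //; first exact: subset_ocD.
rewrite lebesgue_measure_itv/=; case: ifP => _; last by rewrite lte_fin.
rewrite -EFinB lte_fin; apply: le_lt_trans tsd _; rewrite ltr_pdivrMr//; lra.
Qed.

(** ** Linearity, and reduction to controls of minimal norm *)

(** The multiplier condition is imposed at every time, so that it survives
    linear combinations and determines the control almost everywhere. *)
Definition msol x u := sol x u /\ forall t, D t -> minsol (B t) (Rw t) (u t).

Lemma measurable_lin_mx m a (v w : R -> 'cV[R]_m) : measurable_mx D v -> measurable_mx D w ->
  measurable_mx D (fun t => a *: v t + w t).
Proof.
by move=> mv mw; apply: measurable_addmx => //; apply: measurable_scalemx.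
Qed.

Lemma abs_continuous_lin a x y : abs_continuous x -> abs_continuous y ->
  abs_continuous (a *: x + y).
Proof.
move=> xac yac; apply: coord_abs_continuous => i; rewrite ext_lin.
have := abs_cont_lin a (abs_continuous_coord i xac) (abs_continuous_coord i yac).
by congr abs_cont; apply/funext => t; rewrite !mxE.
Qed.

Lemma energy_lin_fin a u v : measurable_mx D u -> measurable_mx D v ->
  (energy mu D Rw u < +oo)%E -> (energy mu D Rw v < +oo)%E ->
  (energy mu D Rw (fun t => a *: u t + v t)%R < +oo)%E.
Proof.
move=> u_meas mv ufin vfin; apply: integrable_lty => //.
pose F t := 2 * (a ^+ 2 * quad (Rw t) (u t) (u t) + quad (Rw t) (v t) (v t)).
apply: (@integrable_dominated _ _ _ _ _ mD _ F).
- by apply: measurable_quad => //; exact: measurable_lin_mx.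
- move=> t Dt; have Pt := Rw_psdD Dt; rewrite ger0_norm; last exact: Pt.2.
  apply: le_trans (quadD_le _ _ Pt) _.
  by rewrite quadZl quadZr /F mulrA -expr2.
- do 2?[apply: integrable_scale => //]; apply: integrable_add => //; last exact: integrable_quad.
  by apply: integrable_scale => //; exact: integrable_quad.
Qed.

Lemma sol_lin a x u y v : sol x u -> sol y v -> sol (a *: x + y) (fun t => a *: u t + v t).
Proof.
move=> [xac u_meas xd ufin] [yac mv yd vfin]; split.
- exact: abs_continuous_lin.
- exact: measurable_lin_mx.
- rewrite ext_lin; apply: filterS2 xd yd => t xd yd tT.
  have := is_deriveD (is_deriveZ a (xd tT)) (yd tT).
  suff -> : rhs (fun s => a *: ext x s + ext y s) (fun s => a *: u s + v s) t =
    a *: rhs (ext x) u t + rhs (ext y) v t by [].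
  by rewrite /rhs !mulmxDr -!scalemxAr scalerDr addrACA.
- exact: energy_lin_fin.
Qed.

Lemma msol_lin a x u y v : msol x u -> msol y v ->
  msol (a *: x + y) (fun t => a *: u t + v t).
Proof.
move=> [xu um] [yv vm]; split; first exact: sol_lin.
by move=> t Dt; apply: minsolD; [exact: um|exact: vm].
Qed.

Lemma msolB x u y v : msol x u -> msol y v -> msol (x - y) (fun t => u t - v t).
Proof.
move=> xu yv; have := msol_lin (-1) yv xu.
rewrite scaleN1r addrC (_ : (fun t => _) = (fun t => u t - v t))//.
by apply/funext => t; rewrite scaleN1r addrC.
Qed.

Lemma msol0 : msol 0 (fun=> 0).
Proof.
split; last by move=> t _; exists 0; rewrite !mulmx0.
split.
- move=> e e0; exists 1 => // n a b _ _ _.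
  by rewrite big1// => i _; rewrite subrr normr0.
- by move=> i j.
- apply: nearW => t _; rewrite ext0 /rhs !mulmx0 addr0; exact: is_derive_cst.
- rewrite /energy (eq_integral (cst 0%E)) ?integral0//.
  by move=> t _; rewrite /quad mulmx0 mxE.
Qed.

(** Minimization at each time keeps B u, hence the state equation, and lowers
    the energy. *)
Lemma sol_minimize x u : sol x u -> exists2 w, msol x w & forall t, D t -> B t *m w t = B t *m u t.
Proof.
move=> [xac u_meas xd ufin]; pose w t := pinv (B t) (Rw t) (B t *m u t).
have wm t : D t -> minsol (B t) (Rw t) (w t).
  by move=> Dt; exact: minsol_pinv r_gt0 (Rw_lbD Dt) (Rw_psdD Dt) _.
have Bw t : D t -> B t *m w t = B t *m u t.
  by move=> Dt; exact: pinv_sol r_gt0 (Rw_lbD Dt) (Rw_psdD Dt) _.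
have mw : measurable_mx D w by exact: measurable_pinv r_gt0 Rw_lbD Rw_psdD mB mRw u_meas.
exists w => //; split=> //; split=> //.
- apply: filterS xd => t xd tT; have Dt : D t by rewrite in_D.
  by have := xd tT; rewrite /rhs (Bw t Dt).
- apply: le_lt_trans ufin; apply: ge0_le_integral => //; try exact: measurable_energy.
  + by move=> t Dt; rewrite lee_fin; exact: (Rw_psdD Dt).2.
  + by move=> t Dt; rewrite lee_fin; apply: (minsol_le (Rw_psdD Dt) (wm t Dt)); rewrite Bw.
Qed.

Lemma traj_msol x : trajectories A B Rw x -> exists u, msol x u.
Proof.
move=> [xac [u [u_meas xd ufin]]].
have [|w xw _] := @sol_minimize x u; last by exists w.
by split=> //; move=> i j; rewrite (ord1 j); exact: u_meas.
Qed.

Lemma sol_traj x u : sol x u -> trajectories A B Rw x.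
Proof.
by move=> [xac u_meas xd ufin]; split=> //; exists u; split => // i; exact: u_meas.
Qed.

(** At a point of differentiability, x' - A x = B u and u is its preimage of
    minimal norm. *)
Lemma msol_control x u : msol x u ->
  {ae mu, forall t : R, 0 <= t <= T -> control A B Rw x t = u t}.
Proof.
move=> [[_ _ xd _] um]; apply: filterS xd => t xd tT.
have Dt : D t by rewrite in_D.
have [_ dE] := xd tT; rewrite /control dE /rhs addrC addKr.
exact: (pinv_minsol r_gt0 (Rw_lbD Dt) (Rw_psdD Dt) (um t Dt)).
Qed.

(** ** The inner product in terms of minimal controls *)

Lemma integrable_state_form x y : abs_continuous x -> abs_continuous y ->
  intD (fun t => quad (Q t) (ext x t) (ext y t)).
Proof.
move=> xac yac; have [m xm] := path_bounded xac; have [k yk] := path_bounded yac.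
apply: (integrable_dominated mD _ _ (integrable_scale mD (m * k) iQ)).
  by apply: measurable_quad => //; exact: path_measurable.
move=> t Dt; apply: le_trans (quad_mxsum _ _ _) _; rewrite mulrC ler_wpM2r ?mxsum_ge0//.
by apply: ler_pM; rewrite ?norm1_ge0 ?xm ?yk.
Qed.

Lemma integrable_control_form u v : measurable_mx D u -> measurable_mx D v ->
  (energy mu D Rw u < +oo)%E -> (energy mu D Rw v < +oo)%E ->
  intD (fun t => quad (Rw t) (u t) (v t)).
Proof.
move=> u_meas mv ufin vfin.
apply: (integrable_dominated mD _ _ (integrable_add mD (integrable_quad u_meas ufin) (integrable_quad mv vfin))).
  exact: measurable_quad.
by move=> t Dt; apply: quad_le; exact: Rw_psdD.
Qed.

Local Notation ip := (ipK A B Q Rw).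

Definition state_form x y := \int[mu]_(t in D) quad (Q t) (ext x t) (ext y t).
Definition control_form u v := \int[mu]_(t in D) quad (Rw t) (u t) (v t).

(** The two sides involve controls that agree almost everywhere.  On the right,
    u and v are measurable and depend linearly on the paths. *)
Lemma ipE x u y v : msol x u -> msol y v ->
  ip x y = quad 1%:M (ext x 0) (ext y 0) + (state_form x y + control_form u v).
Proof.
move=> xu yv; have [[xac u_meas _ ufin] _] := xu; have [[yac mv _ vfin] _] := yv.
have -> : quad 1%:M (ext x 0) (ext y 0) = ((ext x 0)^T *m ext y 0) 0 0.
  by rewrite /quad mulmx1.
rewrite /ipK; congr (_ + _).
rewrite -RintegralD//; [|exact: integrable_state_form|exact: integrable_control_form].
apply: eq_ae_Rintegral.
apply: filterS2 (msol_control xu) (msol_control yv) => t xt yt; rewrite in_D => tT.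
by rewrite xt// yt.
Qed.

Lemma ip_self x u : msol x u ->
  ip x x = sumsq (ext x 0) + (state_form x x + cost u).
Proof. by move=> xu; rewrite (ipE xu xu) quad_scalar mul1r. Qed.

Lemma state_form_ge0 x : 0 <= state_form x x.
Proof. by apply: Rintegral_ge0 => t; rewrite in_D => /Q_psd[_]; apply. Qed.

Lemma ipC x y : trajectories A B Rw x -> trajectories A B Rw y -> ip x y = ip y x.
Proof.
move=> /traj_msol[u xu] /traj_msol[v yv]; rewrite (ipE xu yv) (ipE yv xu).
rewrite quadC ?trmx1//; congr (_ + (_ + _)); apply: eq_Rintegral => t /set_mem Dt.
  by apply: quadC; apply: (Q_psd _).1; rewrite -in_D.
by apply: quadC; exact: (Rw_psdD Dt).1.
Qed.

Lemma ip_lin a x y w : trajectories A B Rw x -> trajectories A B Rw y ->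
  trajectories A B Rw w -> ip (a *: x + y) w = a * ip x w + ip y w.
Proof.
move=> /traj_msol[u xu] /traj_msol[v yv] /traj_msol[z wz].
rewrite (ipE (msol_lin a xu yv) wz) (ipE xu wz) (ipE yv wz).
have [[xac u_meas _ ufin] _] := xu; have [[yac mv _ vfin] _] := yv.
have [[wac mz _ zfin] _] := wz.
have iqx := integrable_state_form xac wac; have iqy := integrable_state_form yac wac.
have irx := integrable_control_form u_meas mz ufin zfin; have iry := integrable_control_form mv mz vfin zfin.
have -> : state_form (a *: x + y) w = a * state_form x w + state_form y w.
  rewrite /state_form -RintegralZl// -RintegralD//; last exact: integrable_scale.
  by apply: eq_Rintegral => t _; rewrite ext_lin quadDl quadZl.
have -> : control_form (fun t => a *: u t + v t) z = a * control_form u z + control_form v z.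
  rewrite /control_form -RintegralZl// -RintegralD//; last exact: integrable_scale.
  by apply: eq_Rintegral => t _; rewrite quadDl quadZl.
by rewrite ext_lin quadDl quadZl; ring.
Qed.

Lemma traj_lin a x y : trajectories A B Rw x -> trajectories A B Rw y ->
  trajectories A B Rw (a *: x + y).
Proof.
move=> /traj_msol[u xu] /traj_msol[v yv].
by have [/sol_traj] := msol_lin a xu yv.
Qed.

Lemma ip_ge0 x : trajectories A B Rw x -> 0 <= ip x x.
Proof.
move=> /traj_msol[u xu]; rewrite (ip_self xu).
by rewrite !addr_ge0 ?sumsq_ge0 ?state_form_ge0 ?cost_ge0.
Qed.

(** Evaluation is continuous: the bound on the unit ball is extended by
    homogeneity. *)
Lemma eval_bounded : exists2 C, 0 <= C & forall x, trajectories A B Rw x ->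
  forall t, 0 <= t <= T -> norm1 (ext x t) <= C * Num.sqrt (ip x x).
Proof.
have [C C0 HC] := sol_bounded; exists C => // x xS t tT.
have [u xu] := traj_msol xS; have s0 := ip_ge0 xS.
have scaled k : 0 < k -> k ^+ 2 * ip x x <= 1 -> k * norm1 (ext x t) <= C.
  move=> k0 ks; have [kxu _] := msol_lin k xu msol0.
  have := HC _ _ kxu; rewrite ext_lin ext0 => H.
  have E : norm1 (k *: ext x t + 0) = k * norm1 (ext x t).
    by rewrite addr0 norm1Z gtr0_norm.
  rewrite -E; apply: (H _ _ t tT).
    have -> : sumsq (k *: ext x 0 + 0) = k ^+ 2 * sumsq (ext x 0).
      by rewrite addr0 mulr_sumr; apply: eq_bigr => i _; rewrite mxE exprMn.
    apply: le_trans ks; rewrite ler_pM2l ?exprn_gt0// (ip_self xu) lerDl.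
    by rewrite addr_ge0 ?state_form_ge0 ?cost_ge0.
  have -> : cost (fun t => k *: u t + 0) = k ^+ 2 * cost u.
    rewrite /cost -RintegralZl//; last by case: xu => -[_ u_meas _ ufin] _; exact: integrable_quad.
    by apply: eq_Rintegral => w _; rewrite addr0 quadZl quadZr mulrA -expr2.
  apply: le_trans ks; rewrite ler_pM2l ?exprn_gt0// (ip_self xu) addrA lerDr.
  by rewrite addr_ge0 ?state_form_ge0 ?sumsq_ge0.
have [s_eq0|s_gt0] := leP (ip x x) 0.
  rewrite (_ : ip x x = 0); last by apply/eqP; rewrite eq_le s_eq0.
  rewrite sqrtr0 mulr0 leNgt; apply/negP => n0.
  have k0 : 0 < (C + 1) / norm1 (ext x t) by rewrite divr_gt0// ltr_wpDl.
  have := scaled _ k0; rewrite divfK ?gt_eqF// => H.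
  have : C + 1 <= C by apply: H; rewrite (_ : ip x x = 0) ?mulr0//; apply/eqP; rewrite eq_le s_eq0.
  by rewrite leNgt ltrDl ltr01.
have q0 : 0 < Num.sqrt (ip x x) by rewrite sqrtr_gt0.
rewrite mulrC -ler_pdivrMl//; apply: scaled; first by rewrite invr_gt0.
by rewrite exprVn sqr_sqrtr// mulVf// gt_eqF.
Qed.

Lemma ip_def x : trajectories A B Rw x -> ip x x = 0 -> x = 0.
Proof.
move=> xS x0; have [C _ /(_ _ xS) HC] := eval_bounded.
apply/funext => s; have := HC (val s) (valP s).
by rewrite x0 sqrtr0 mulr0 ext_val => /norm1_eq0.
Qed.

(** ** Completeness *)

(** Absolute continuity and the differential equation are those of primitives;
    the end points, where the extended path may jump, form a null set. *)
Lemma integral_sol x u : measurable_mx D u -> (energy mu D Rw u < +oo)%E ->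
  (forall i, intD (fun t => rhs (ext x) u t i 0)) ->
  (forall i t, 0 <= t <= T ->
    ext x t i 0 = ext x 0 i 0 + primitive (fun s => rhs (ext x) u s i 0) t) ->
  sol x u.
Proof.
move=> u_meas ufin ig xE; split=> //.
  apply: coord_abs_continuous => i e e0.
  have [d d0 Hd] := primitive_abs_cont (ig i) e0.
  exists d => // n a b ab tab sd; apply: le_lt_trans (Hd n a b ab tab sd).
  apply: ler_sum => j _; have [a0 ajb bT] := ab j.
  rewrite (xE i (a j)) ?(xE i (b j)) ?a0 ?bT ?(le_trans ajb) ?(le_trans a0)//.
  by rewrite opprD addrACA subrr add0r.
have neq_ae a : {ae mu, forall t : R, t != a}.
  exists [set a]; split; [exact: measurable_set1|exact: lebesgue_measure_set1|].
  by move=> t /= /negP; rewrite negbK => /eqP.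
have dP : {ae mu, forall t : R, forall i, 0 <= t <= T ->
    is_derive t 1 (primitive (fun s => rhs (ext x) u s i 0)) (rhs (ext x) u t i 0)}.
  by apply: filter_forall => i; exact: primitive_is_derive.
apply: filterS3 dP (neq_ae 0) (neq_ae T) => t dP tn0 tnT tT.
apply: coord_is_derive => i.
have /andP[t_gt0 t_ltT] : 0 < t < T.
  by move: tT => /andP[t0 tT]; rewrite !lt_neqAle tnT tT t0 eq_sym tn0.
have near_eq : {near t, (fun s => ext x 0 i 0 + primitive (fun s => rhs (ext x) u s i 0) s) =1
    (fun s => ext x s i 0)}.
  near=> s; rewrite -xE//; apply/andP; split; apply: ltW; near: s.
    exact: lt_nbhsr.
  exact: lt_nbhsl.
have dc := is_deriveD (is_derive_cst (ext x 0 i 0) t 1) (dP i tT).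
rewrite add0r in dc; have [d1 d2] := dc.
apply: DeriveDef; first exact: near_eq_derivable d1.
by rewrite -(near_eq_derive _ near_eq).
Unshelve. all: by end_near. Qed.

Lemma cvg_norm1 m (w : nat -> 'cV[R]_m) (l : 'cV[R]_m) :
  (forall i, w k i 0 @[k --> \oo] --> l i 0) -> norm1 (w k) @[k --> \oo] --> norm1 l.
Proof.
move=> wl; apply: cvg_big => [|i _]; first exact: add_continuous.
by apply: cvg_norm; exact: wl.
Qed.

Lemma uniform_limit (f_ : nat -> seg T -> 'cV[R]_N) :
  (forall e : R, 0 < e -> exists n0, forall m n, (n0 <= m)%N -> (n0 <= n)%N ->
     forall s, norm1 (f_ m s - f_ n s) <= e) ->
  exists f : seg T -> 'cV[R]_N, (forall s i, f_ n s i 0 @[n --> \oo] --> f s i 0) /\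
    forall e : R, 0 < e -> exists n0, forall n, (n0 <= n)%N -> forall s, norm1 (f_ n s - f s) <= e.
Proof.
move=> cauchy_f.
have cvgf s i : cvgn (fun n => f_ n s i 0).
  apply: R_complete; apply: cauchy_exP => e e0.
  have [n0 Hn0] := cauchy_f (e / 2) (divr_gt0 e0 (ltr0Sn _ 1)).
  exists (f_ n0 s i 0); exists n0 => // n /= n0n.
  rewrite /ball/=; apply: (@le_lt_trans _ _ (e / 2)); last by rewrite ltr_pdivrMr//; lra.
  apply: le_trans (Hn0 n0 n (leqnn _) n0n s); apply: le_trans (norm1_coord _ i).
  by rewrite !mxE.
pose f s : 'cV[R]_N := \col_i limn (fun n => f_ n s i 0).
have fP s i : f_ n s i 0 @[n --> \oo] --> f s i 0 by rewrite mxE; exact: cvgf.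
exists f; split=> // e /cauchy_f[n0 Hn0]; exists n0 => n n0n s.
have c : norm1 (f_ n s - f_ k s) @[k --> \oo] --> norm1 (f_ n s - f s).
  apply: cvg_norm1 => i.
  rewrite (_ : (fun k => _) = (fun k => f_ n s i 0 - f_ k s i 0)); last first.
    by apply/funext => k; rewrite !mxE.
  have -> : (f_ n s - f s) i 0 = f_ n s i 0 - f s i 0 by rewrite 2!mxE.
  by apply: cvgB; [exact: cvg_cst|exact: fP].
rewrite -(cvg_lim _ c)//; apply: limr_le; first by apply/cvg_ex; eexists; exact: c.
by exists n0 => // k /= n0k; exact: Hn0.
Qed.

(** The integrated state equation is stable under uniform convergence of the
    states and convergence of the controls in energy: both errors contribute a
    multiple of e to the integral of A x + B u. *)
Lemma sol_limit (f_ : nat -> seg T -> 'cV[R]_N) (U : nat -> R -> 'cV[R]_M)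
    (f : seg T -> 'cV[R]_N) V :
  (forall n, sol (f_ n) (U n)) -> measurable_mx D V ->
  (forall s i, f_ n s i 0 @[n --> \oo] --> f s i 0) ->
  (forall e : R, 0 < e -> exists n0, forall n, (n0 <= n)%N ->
     forall s, norm1 (f_ n s - f s) <= e) ->
  (forall e : R, 0 < e -> exists n0, forall n, (n0 <= n)%N ->
     (energy mu D Rw (fun t => U n t - V t)%R <= e%:E)%E) ->
  sol f V.
Proof.
move=> f_U mV fcvg funif UV.
have Vfin : (energy mu D Rw V < +oo)%E.
  have [n0 /(_ n0 (leqnn _)) H] := UV 1 ltr01.
  have [_ mUn _ Unfin] := f_U n0.
  have -> : V = (fun t => (-1) *: (U n0 t - V t) + U n0 t).
    by apply/funext => t; rewrite scaleN1r opprB subrK.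
  apply: energy_lin_fin => //; first exact: measurable_subfun.
  by apply: le_lt_trans H _; exact: ltry.
have ext_unif e : 0 < e -> exists n0, forall n, (n0 <= n)%N ->
    forall t, 0 <= t <= T -> norm1 (ext (f_ n) t - ext f t) <= e.
  move=> /funif[n0 Hn0]; exists n0 => n n0n t tT.
  by rewrite !(ext_seg _ tT); exact: Hn0.
have mf : measurable_mx D (ext f).
  move=> i j; rewrite (ord1 j).
  apply: (@measurable_fun_cvg _ _ _ _ (fun n t => ext (f_ n) t i 0)).
    by move=> n; have [xac _ _ _] := f_U n; exact: (path_measurable xac).
  move=> t; rewrite in_D => tT; rewrite (ext_seg _ tT).
  rewrite (_ : (fun n => _) = (fun n => f_ n (exist _ t tT) i 0)); last first.
    by apply/funext => n; rewrite ext_seg.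
  exact: fcvg.
have [m fm] : exists m, forall t, D t -> norm1 (ext f t) <= m.
  have [n0 /(_ n0 (leqnn _)) H] := ext_unif 1 ltr01.
  have [xac _ _ _] := f_U n0; have [m xm] := path_bounded xac.
  exists (1 + m) => t Dt; have tT : 0 <= t <= T by rewrite -in_D.
  have -> : ext f t = - (ext (f_ n0) t - ext f t) + ext (f_ n0) t by rewrite opprB subrK.
  by apply: le_trans (norm1D _ _) _; rewrite norm1N lerD ?H ?xm.
have [_ ig] := integrable_rhs mV Vfin mf fm.
apply: integral_sol => // i t tT.
have D0 : D 0 by rewrite in_D lexx ltW.
pose a := \int[mu]_(s in D) mxsum (A s).
pose b := \int[mu]_(s in D) mxsq (B s).
pose K := 2 + a + (b + N%:R * r^-1).
have a0 : 0 <= a by apply: Rintegral_ge0 => s _; exact: mxsum_ge0.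
have b0 : 0 <= b by apply: Rintegral_ge0 => s _; exact: mxsq_ge0.
have Nr0 : 0 <= N%:R * r^-1 by rewrite mulr_ge0// invr_ge0 ltW.
have K0 : 0 < K by rewrite /K ltr_pwDl ?addr_ge0// ltr_pwDl.
suff H e : 0 < e -> `|ext f t i 0 - (ext f 0 i 0 + primitive (fun s => rhs (ext f) V s i 0) t)| <= K * e.
  apply/eqP; rewrite -subr_eq0 -normr_le0; apply/ler_addgt0Pl => e e0; rewrite addr0.
  by have := H (e / K) (divr_gt0 e0 K0); rewrite mulrC divfK// gt_eqF.
move=> e0.
have [n1 Hn1] := ext_unif e e0.
have [n2 Hn2] := UV (e ^+ 2) (exprn_gt0 _ e0).
pose n := maxn n1 n2.
have {Hn1}Fn := Hn1 n (leq_maxl _ _); have {Hn2}Un := Hn2 n (leq_maxr _ _).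
have [xac mUn _ Unfin] := f_U n.
pose dU s := U n s - V s; pose df s := ext (f_ n) s - ext f s.
have mdU : measurable_mx D dU by exact: measurable_subfun.
have mdf : measurable_mx D df by apply: measurable_subfun => //; exact: path_measurable.
have dUfin : (energy mu D Rw dU < +oo)%E by apply: le_lt_trans Un _; exact: ltry.
have dUcost : cost dU <= e ^+ 2 by rewrite -lee_fin -energyE.
have dfe s : D s -> norm1 (df s) <= e by rewrite in_D; exact: Fn.
have [i1 _] := integrable_rhs mdU dUfin mdf dfe.
have [_ ign] := sol_integrable (f_U n).
have iBdU := integrable_norm1_Bu mdU dUfin.
have P : `|primitive (fun s => rhs (ext (f_ n)) (U n) s i 0) t -
    primitive (fun s => rhs (ext f) V s i 0) t| <= (a + (b + N%:R * r^-1)) * e.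
  have tD : `[0, t]%classic `<=` D by apply: subset_itvl; rewrite bnd_simp; case/andP: tT.
  rewrite /primitive -RintegralB//; [|exact: (integrable_subitv (ign i))|exact: (integrable_subitv (ig i))].
  apply: le_trans (le_normr_Rintegral _ _) _ => //.
    by apply: integrable_sub_fun => //; [exact: (integrable_subitv (ign i))|exact: (integrable_subitv (ig i))].
  apply: (@le_trans _ _ (\int[mu]_(s in D) norm1 (rhs df dU s))).
    apply: (@le_trans _ _ (\int[mu]_(s in `[0, t]) norm1 (rhs df dU s))).
      apply: le_Rintegral => //.
      - apply: integrable_normr => //.
        by apply: integrable_sub_fun => //; [exact: (integrable_subitv (ign i))|exact: (integrable_subitv (ig i))].
      - exact: integrableS i1.
      move=> s _; apply: le_trans (norm1_coord _ i).
      by rewrite /rhs /df /dU !mulmxBr addrACA -opprD !mxE.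
    rewrite /Rintegral fine_le ?integrable_fin_num//; first exact: integrableS i1.
    apply: ge0_subset_integral => //; first by case/integrableP : i1.
    by move=> s _; rewrite lee_fin norm1_ge0.
  apply: (@le_trans _ _ (\int[mu]_(s in D) (e * mxsum (A s) + norm1 (B s *m dU s)))).
    apply: le_Rintegral => //; first by apply: integrable_add => //; exact: integrable_scale.
    move=> s Ds; apply: le_trans (norm1D _ _) _; rewrite lerD2r.
    by apply: le_trans (norm1_mulmx _ _) _; rewrite mulrC ler_wpM2r ?mxsum_ge0 ?dfe.
  rewrite RintegralD//; last exact: integrable_scale.
  rewrite RintegralZl// mulrDl [a * e]mulrC lerD2l.
  apply: le_trans (norm1_Bu_le mdU dUfin e0) _.
  rewrite mulrDl [b * e]mulrC lerD2l ler_pdivrMl//.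
  rewrite (_ : e * _ = N%:R * (r^-1 * e ^+ 2)); last by ring.
  by do 2!rewrite ler_wpM2l ?invr_ge0 ?(ltW r_gt0)//.
rewrite (_ : _ - _ = (ext (f_ n) 0 i 0 - ext f 0 i 0) - (ext (f_ n) t i 0 - ext f t i 0)
  + (primitive (fun s => rhs (ext (f_ n)) (U n) s i 0) t -
     primitive (fun s => rhs (ext f) V s i 0) t)); last first.
  by rewrite (sol_integral i (f_U n) tT); ring.
have c0 : `|ext (f_ n) 0 i 0 - ext f 0 i 0| <= e.
  by apply: le_trans (dfe 0 D0); apply: le_trans (norm1_coord _ i); rewrite !mxE.
have ct : `|ext (f_ n) t i 0 - ext f t i 0| <= e.
  by apply: le_trans (Fn t tT); apply: le_trans (norm1_coord _ i); rewrite !mxE.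
apply: le_trans (ler_normD _ _) _.
rewrite (_ : K * e = (e + e) + (a + (b + N%:R * r^-1)) * e); last by rewrite /K; ring.
by apply: lerD => //; apply: le_trans (ler_normB _ _) _; exact: lerD.
Qed.

(** The limit V of the controls yields the limit path, and its minimal control w
    yields the distance to it, since u_n - w is at most as costly as u_n - V. *)
Lemma ip_complete (f_ : nat -> seg T -> 'cV[R]_N) : (forall n, trajectories A B Rw (f_ n)) ->
  (forall e : R, 0 < e -> exists n0, forall m n, (n0 <= m)%N -> (n0 <= n)%N ->
     Num.sqrt (ip (f_ m - f_ n) (f_ m - f_ n)) < e) ->
  exists2 f, trajectories A B Rw f &
    (fun n => Num.sqrt (ip (f_ n - f) (f_ n - f))) @ \oo --> (0 : R).
Proof.
move=> f_S cauchy_f.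
have /choice[U f_U] : forall n, exists u, msol (f_ n) u by move=> n; exact: traj_msol.
have subS m n : trajectories A B Rw (f_ m - f_ n).
  by have [/sol_traj] := msolB (f_U m) (f_U n).
have [C C0 HC] := eval_bounded.
have C1 : 0 < C + 1 by rewrite ltr_wpDl.
have [f [fcvg funif]] : exists f : seg T -> 'cV[R]_N,
    (forall s i, f_ n s i 0 @[n --> \oo] --> f s i 0) /\
    forall e : R, 0 < e -> exists n0, forall n, (n0 <= n)%N -> forall s, norm1 (f_ n s - f s) <= e.
  apply: uniform_limit => e e0.
  have [n0 Hn0] := cauchy_f (e / (C + 1)) (divr_gt0 e0 C1).
  exists n0 => m n n0m n0n s; have := HC _ (subS m n) (val s) (valP s).
  rewrite ext_val => H; apply: le_trans H _.
  have := ltW (Hn0 m n n0m n0n); rewrite ler_pdivlMr// => H; apply: le_trans H.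
  by rewrite mulrC ler_wpM2l ?sqrtr_ge0// lerDl.
have costB m n : cost (fun t => U m t - U n t) <= ip (f_ m - f_ n) (f_ m - f_ n).
  rewrite (ip_self (msolB (f_U m) (f_U n))) addrA lerDr.
  by rewrite addr_ge0 ?sumsq_ge0 ?state_form_ge0.
have [V mV UV] : exists2 V, measurable_mx D V & forall e : R, 0 < e ->
    exists n0, forall n, (n0 <= n)%N -> (energy mu D Rw (fun t => U n t - V t)%R <= e%:E)%E.
  apply: (energy_complete mD r_gt0 Rw_lbD Rw_psdD mRw).
    by move=> n; have [[_ mUn _ _] _] := f_U n.
  move=> e e0; have se0 : 0 < Num.sqrt e by rewrite sqrtr_gt0.
  have [n0 Hn0] := cauchy_f _ se0.
  exists n0 => m n n0m n0n.
  have [[_ _ _ fin] _] := msolB (f_U m) (f_U n).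
  rewrite energyE// lee_fin; apply: le_trans (costB m n) _.
  have := Hn0 m n n0m n0n; rewrite ltr_sqrt//; exact: ltW.
have fV : sol f V by exact: sol_limit (fun n => (f_U n).1) mV fcvg funif UV.
have [W fW BW] := sol_minimize fV.
exists f; first by have [/sol_traj] := fW.
pose q := \int[mu]_(t in D) mxsum (Q t).
have q0 : 0 <= q by apply: Rintegral_ge0 => t _; exact: mxsum_ge0.
have q2 : 0 < 2 + q by rewrite ltr_pwDl.
apply/cvgrPdist_lt => e e0; pose h := e / (2 + q).
have h0 : 0 < h by rewrite divr_gt0.
have [n1 Hn1] := funif h h0; have [n2 Hn2] := UV (h ^+ 2) (exprn_gt0 _ h0).
exists (maxn n1 n2) => // n /=; rewrite geq_max => /andP[/Hn1 fn /Hn2 un].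
rewrite sub0r normrN ger0_norm ?sqrtr_ge0//.
have fn' t : 0 <= t <= T -> norm1 (ext (f_ n - f) t) <= h.
  by move=> tT; rewrite (ext_seg _ tT); exact: fn.
have nW := msolB (f_U n) fW.
have [[dac mUW _ UWfin] _] := nW.
have costUW : cost (fun t => U n t - W t) <= h ^+ 2.
  rewrite -lee_fin -energyE//; apply: le_trans un; apply: ge0_le_integral => //;
    try (apply: measurable_energy => //; apply: measurable_subfun => //; by have [[]] := f_U n).
  - by move=> t Dt; rewrite lee_fin; exact: (Rw_psdD Dt).2.
  - move=> t Dt; rewrite lee_fin; apply: (minsol_le (Rw_psdD Dt)); first exact: nW.2.
    by rewrite !mulmxBr BW.
have stateQ : state_form (f_ n - f) (f_ n - f) <= h ^+ 2 * q.
  rewrite /state_form -RintegralZl//; apply: le_Rintegral => //.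
  - exact: integrable_state_form.
  - exact: integrable_scale.
  move=> t; rewrite in_D => tT; apply: le_trans (ler_norm _) _.
  apply: le_trans (quad_mxsum _ _ _) _; rewrite mulrC ler_wpM2r ?mxsum_ge0// expr2.
  by apply: ler_pM; rewrite ?norm1_ge0 ?fn'.
have init : sumsq (ext (f_ n - f) 0) <= h ^+ 2.
  apply: le_trans (sumsq_norm1 _) _.
  by rewrite ler_pXn2r ?nnegrE ?norm1_ge0 ?(ltW h0)// fn' ?lexx ?ltW.
rewrite -(@ltr_pXn2r _ 2)// ?nnegrE ?sqrtr_ge0 ?(ltW e0)// sqr_sqrtr; last first.
  by apply: ip_ge0; have [/sol_traj] := nW.
rewrite (ip_self nW); apply: (@le_lt_trans _ _ (h ^+ 2 * (2 + q))).
  by rewrite (_ : _ * _ = h ^+ 2 + (h ^+ 2 * q + h ^+ 2)); [rewrite !lerD|ring].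
rewrite {1}expr2 {2}/h -mulrA divfK ?gt_eqF// expr2 ltr_pM2r//.
by rewrite /h ltr_pdivrMr// ltr_pMr//; lra.
Qed.

Lemma traj0 : trajectories A B Rw (0 : seg T -> 'cV[R]_N).
Proof. by have [/sol_traj] := msol0. Qed.

Theorem trajectories_hilbert : is_hilbert (@trajectories R T N M A B Rw) ip.
Proof.
split.
- exact: traj0.
- by move=> a f g; exact: traj_lin.
- exact: ipC.
- exact: ip_lin.
- exact: ip_ge0.
- exact: ip_def.
- exact: ip_complete.
Qed.

(** Column j of K(., t) represents the bounded functional that sends f to the
    j-th coordinate of f(t); linearity in p does the rest. *)
Theorem trajectories_vRKHS : is_vRKHS (@trajectories R T N M A B Rw) ip.
Proof.
have hH := trajectories_hilbert; split=> //.
  by exists (exist _ 0 (introT andP (conj (lexx 0) (ltW T_gt0)))).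
have [C C0 HC] := eval_bounded.
have /choice[k kP] : forall ti : seg T * 'I_N, exists k, trajectories A B Rw k /\
    forall f, trajectories A B Rw f -> f ti.1 ti.2 0 = ip f k.
  move=> [t i]; have [|f fS|k kS Hk] := riesz hH (L := fun f : seg T -> 'cV[R]_N => f t i 0) C0.
  - by move=> a f g _ _; rewrite !mxE.
  - have := HC f fS (val t) (valP t); rewrite ext_val; apply: le_trans.
    exact: norm1_coord.
  - by exists k.
exists (fun s t => \matrix_(i, j) k (t, j) s i 0) => t p.
have KE : (fun s => (\matrix_(i, j) k (t, j) s i 0) *m p) = \sum_j p j 0 *: k (t, j).
  apply/funext => s; apply/colP => i.
  rewrite fct_sumE summxE mxE; apply: eq_bigr => j _.
  by rewrite !mxE mulrC.
have sumP (s : seq 'I_N) : trajectories A B Rw (\sum_(j <- s) p j 0 *: k (t, j)) /\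
   forall f, trajectories A B Rw f ->
     ip f (\sum_(j <- s) p j 0 *: k (t, j)) = \sum_(j <- s) p j 0 * f t j 0.
  elim: s => [|j s [IH1 IH2]].
    rewrite big_nil; split; first exact: traj0.
    by move=> f fS; rewrite big_nil ipC ?(ip0l hH)//; exact: traj0.
  have [kS kf] := kP (t, j); have pkS := hilbertZ hH (p j 0) kS.
  rewrite big_cons; split; first exact: (hilbertD hH pkS IH1).
  by move=> f fS; rewrite (ipDr hH pkS IH1 fS) (ipZr hH _ kS fS) -kf// IH2// big_cons.
rewrite KE; have [S1 S2] := sumP (index_enum 'I_N); split=> // f fS.
by rewrite S2// mxE; apply: eq_bigr => j _; rewrite mxE.
Qed.

End trajectory.

Theorem lemma1 (R : realType) (T : R) (N M : nat)
    (A : R -> 'M[R]_N) (B : R -> 'M[R]_(N, M))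
    (Q : R -> 'M[R]_N) (Rw : R -> 'M[R]_M)
    (T_gt0 : 0 < T) (N_ge1 : (1 <= N)%N) (M_ge1 : (1 <= M)%N)
    (Q_psd : forall t : R, 0 <= t <= T -> psd (Q t))
    (Rw_psd : forall t : R, 0 <= t <= T -> psd (Rw t))
    (A_L1 : Lp_mx T 1 A) (B_L2 : Lp_mx T 2 B)
    (Q_L1 : Lp_mx T 1 Q) (Rw_L2 : Lp_mx T 2 Rw)
    (Rw_ge : exists2 r : R, 0 < r &
       forall t : R, 0 <= t <= T -> psd (Rw t - r%:M)) :
  is_vRKHS (@trajectories R T N M A B Rw) (ipK A B Q Rw).
Proof.
have [r r_gt0 Rw_lb] := Rw_ge.
exact: (trajectories_vRKHS T_gt0 Q_psd Rw_psd A_L1 B_L2 Q_L1 Rw_L2 r_gt0 Rw_lb).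
Qed.
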